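(* Let $(R,\mathfrak{m},k)$ be a Noetherian local ring and let $J,K$ be ideals of $R$. Let $(P)$ be any one of the properties ''$\mathfrak{m}$-full'', ''weakly $\mathfrak{m}$-full'', ''full''. Then the following are equivalent: (1) $J$ has property $(P)$; (2) there exists $n_0$ such that $J+K\mathfrak{m}^n$ has property $(P)$ for all $n\geq n_0$.
   Context: Let $(R,\mathfrak{m},k)$ be a local ring. When $k$ is infinite, an ideal $I$ is called $\mathfrak{m}$-full if $\mathfrak{m}I:x=I$ for a general element $x\in\mathfrak{m}$, and full if $I:x=I:\mathfrak{m}$ for a general element $x\in\mathfrak{m}$; here ''for a general element $x\in\mathfrak{m}$'' means for all $x\in\mathfrak{m}$ whose image in $\mathfrak{m}/\mathfrak{m}^2$ lies in some nonempty Zariski open subset of $\mathfrak{m}/\mathfrak{m}^2$. When $k$ is finite, $I$ is called $\mathfrak{m}$-full (resp. full) if $IS'$ is $\mathfrak{m}S'$-full (resp. full) in the faithfully flat extension $S'=S_{\mathfrak{m}S}$, where $S=R[X_1,\dots,X_n]$ with $n=\mu(\mathfrak{m})$ the minimal number of generators of $\mathfrak{m}$. An ideal $I$ is weakly $\mathfrak{m}$-full if $\mathfrak{m}I:\mathfrak{m}=I$. Colon: $A:B=\{r\in R: rB\subseteq A\}$, $A:x=\{r: rx\in A\}$. *)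

(* Defs.v *)
From HB Require Import structures.
From mathcomp Require Import all_boot all_order all_algebra.
From mathcomp Require Import generic_quotient.
From mathcomp Require Import ring.
From mathcomp Require Import mpoly.
From Stdlib Require Import ClassicalDescription.

Set Implicit Arguments.
Unset Strict Implicit.
Unset Printing Implicit Defensive.

Import GRing.Theory.
Local Open Scope ring_scope.
Local Open Scope quotient_scope.

Definition asb (P : Prop) : bool :=
  if excluded_middle_informative P then true else false.

Lemma asbP (P : Prop) : reflect P (asb P).
Proof. by rewrite /asb; case: excluded_middle_informative => h; constructor. Qed.

Section Ideals.
Variable T : comNzRingType.
Implicit Types I J M : T -> Prop.

Definition is_ideal I :=
  [/\ I 0, (forall x y, I x -> I y -> I (x + y)) & (forall r x, I x -> I (r * x))].

Definition ideal_eq I J := forall z, I z <-> J z.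

Definition ideal_sum I J : T -> Prop :=
  fun z => exists x y, [/\ I x, J y & z = x + y].

Definition ideal_mul I J : T -> Prop :=
  fun z => exists k (a b : 'I_k -> T),
    [/\ forall i, I (a i), forall i, J (b i) & z = \sum_(i < k) a i * b i].

Fixpoint ideal_pow I (n : nat) : T -> Prop :=
  if n is n'.+1 then ideal_mul (ideal_pow I n') I else (fun _ => True).

Definition colon I J : T -> Prop := fun r => forall y, J y -> I (r * y).
Definition colon_elt I (x : T) : T -> Prop := fun r => I (r * x).

Definition generated_by k (g : 'I_k -> T) : T -> Prop :=
  fun z => exists c : 'I_k -> T, z = \sum_(i < k) c i * g i.

Definition is_local M :=
  [/\ is_ideal M, ~ M 1 & forall x, ~ M x -> exists y, x * y = 1].

Definition noetherian :=
  forall I, is_ideal I -> exists k (g : 'I_k -> T), ideal_eq I (generated_by g).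

Definition min_gens M n (g : 'I_n -> T) :=
  ideal_eq M (generated_by g) /\
  forall k (h : 'I_k -> T), ideal_eq M (generated_by h) -> (n <= k)%N.

Definition mu M n := exists g : 'I_n -> T, min_gens M g.

Definition res_infinite M :=
  forall s : seq T, exists x, forall y, y \in s -> ~ M (x - y).

(* "P x holds for a general element x of M".  Using a minimal system of
   generators g_1..g_n of M, m/m^2 is identified with k^n via
   sum a_i g_i |-> (a_1 mod M, ..., a_n mod M).  A nonempty Zariski open
   subset contains a basic open set D(fbar) with fbar a nonzero polynomial
   over k = T/M; fbar is represented by a lift f in T[X_1..X_n] having some
   coefficient outside M, and fbar(abar) != 0 iff f(a) is not in M. *)
Definition general_elt M (P : T -> Prop) :=
  exists n (g : 'I_n -> T), min_gens M g /\
  exists f : {mpoly T[n]}, (exists e : 'X_{1..n}, ~ M f@_e) /\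
    forall a : 'I_n -> T, ~ M f.@[a] -> P (\sum_(i < n) a i * g i).

Definition mfull_gen M I :=
  general_elt M (fun x => ideal_eq (colon_elt (ideal_mul M I) x) I).
Definition full_gen M I :=
  general_elt M (fun x => ideal_eq (colon_elt I x) (colon I M)).

Definition weakly_mfull M I := ideal_eq (colon (ideal_mul M I) M) I.

End Ideals.

Definition ideal_ext (A B : comNzRingType) (phi : A -> B) (I : A -> Prop)
  : B -> Prop :=
  fun z => exists k (c : 'I_k -> B) (a : 'I_k -> A),
    (forall i, I (a i)) /\ z = \sum_(i < k) c i * phi (a i).

(* Given a predicate P, we localize at P if P is a multiplicative set not    *)
(* containing 0 (the only case used below), and at {1} otherwise (a dummy    *)
(* choice making the construction total).                                    *)
Module Loc.
Section Loc.
Variables (A : comNzRingType) (P : A -> Prop).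

Definition good := [/\ P 1, (forall a b, P a -> P b -> P (a * b)) & ~ P 0].

Definition S : pred A := fun a => if asb good then asb (P a) else a == 1.

Lemma S1 : S 1.
Proof.
rewrite /S; case: asbP => [[h _ _]|_]; [exact/asbP | exact: eqxx].
Qed.

Lemma SM a b : S a -> S b -> S (a * b).
Proof.
rewrite /S; case: asbP => [[_ h _]|_].
  by move=> /asbP ha /asbP hb; apply/asbP; exact: h.
by move=> /eqP -> /eqP ->; rewrite mulr1.
Qed.

Lemma S0 : ~ S 0.
Proof.
rewrite /S; case: asbP => [[_ _ h]|_]; first by move=> /asbP.
by rewrite eq_sym oner_eq0.
Qed.

Definition den := {a : A | S a}.
Definition dom := (A * den)%type.

Definition one_den : den := exist _ 1 S1.
Definition mul_den (s t : den) : den := exist _ (val s * val t) (SM (valP s) (valP t)).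

Definition equivl (x y : dom) : bool :=
  asb (exists u, S u /\ u * (x.1 * val y.2 - y.1 * val x.2) = 0).

Lemma equiv_of (x y : dom) : x.1 * val y.2 = y.1 * val x.2 -> equivl x y.
Proof. by move=> h; apply/asbP; exists 1; split; [exact: S1|rewrite h subrr mulr0]. Qed.

Lemma equivl_refl : reflexive equivl.
Proof. by move=> x; apply: equiv_of. Qed.

Lemma equivl_sym : ssrbool.symmetric equivl.
Proof.
move=> x y; apply/asbP/asbP => -[u [Su h]]; exists u; split => //.
  by rewrite -opprB mulrN h oppr0.
by rewrite -opprB mulrN h oppr0.
Qed.

Lemma equivl_trans : transitive equivl.
Proof.
move=> y x z /asbP [u [Su hu]] /asbP [v [Sv hv]]; apply/asbP.
exists (u * v * val y.2); split; first by rewrite SM // ?SM // valP.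
have -> : u * v * val y.2 * (x.1 * val z.2 - z.1 * val x.2) =
  v * val z.2 * (u * (x.1 * val y.2 - y.1 * val x.2)) +
  u * val x.2 * (v * (y.1 * val z.2 - z.1 * val y.2)) by ring.
by rewrite hu hv !mulr0 addr0.
Qed.

Canonical equivl_equiv := EquivRel equivl equivl_refl equivl_sym equivl_trans.

Definition type := {eq_quot equivl}.
HB.instance Definition _ : EqQuotient _ equivl type := EqQuotient.on type.
HB.instance Definition _ := Choice.on type.

Lemma equivlE (x y : dom) : (x == y %[mod type]) = equivl x y.
Proof. by rewrite eqmodE. Qed.

Definition addl (x y : dom) : dom := (x.1 * val y.2 + y.1 * val x.2, mul_den x.2 y.2).
Definition mull (x y : dom) : dom := (x.1 * y.1, mul_den x.2 y.2).
Definition oppl (x : dom) : dom := (- x.1, x.2).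

Lemma addl_compat x x' y y' : equivl x x' -> equivl y y' ->
  equivl (addl x y) (addl x' y').
Proof.
move=> /asbP [u [Su hu]] /asbP [v [Sv hv]]; apply/asbP; exists (u * v).
split; first exact: SM.
rewrite /=.
have -> : u * v * ((x.1 * val y.2 + y.1 * val x.2) * (val x'.2 * val y'.2) -
     (x'.1 * val y'.2 + y'.1 * val x'.2) * (val x.2 * val y.2)) =
  v * val y.2 * val y'.2 * (u * (x.1 * val x'.2 - x'.1 * val x.2)) +
  u * val x.2 * val x'.2 * (v * (y.1 * val y'.2 - y'.1 * val y.2)) by ring.
by rewrite hu hv !mulr0 addr0.
Qed.

Lemma mull_compat x x' y y' : equivl x x' -> equivl y y' ->
  equivl (mull x y) (mull x' y').
Proof.
move=> /asbP [u [Su hu]] /asbP [v [Sv hv]]; apply/asbP; exists (u * v).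
split; first exact: SM.
rewrite /=.
have -> : u * v * (x.1 * y.1 * (val x'.2 * val y'.2) -
     x'.1 * y'.1 * (val x.2 * val y.2)) =
  v * y.1 * val y'.2 * (u * (x.1 * val x'.2 - x'.1 * val x.2)) +
  u * x'.1 * val x.2 * (v * (y.1 * val y'.2 - y'.1 * val y.2)) by ring.
by rewrite hu hv !mulr0 addr0.
Qed.

Lemma oppl_compat x x' : equivl x x' -> equivl (oppl x) (oppl x').
Proof.
move=> /asbP [u [Su hu]]; apply/asbP; exists u; split => //=.
have -> : u * (- x.1 * val x'.2 - - x'.1 * val x.2) =
  - (u * (x.1 * val x'.2 - x'.1 * val x.2)) by ring.
by rewrite hu oppr0.
Qed.

Lemma repr_equiv (x : dom) : equivl (repr (\pi_type x)) x.
Proof. by rewrite -equivlE reprK. Qed.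

Definition zero : type := \pi_type (0, one_den).
Definition one : type := \pi_type (1, one_den).
Definition add := lift_op2 type addl.
Definition mul := lift_op2 type mull.
Definition opp := lift_op1 type oppl.

Lemma pi_add : {morph \pi : x y / addl x y >-> add x y}.
Proof.
move=> x y; unlock add; apply/eqmodP; rewrite /=.
by apply: addl_compat; rewrite equivl_sym; exact: repr_equiv.
Qed.
Canonical pi_add_morph := PiMorph2 pi_add.

Lemma pi_mul : {morph \pi : x y / mull x y >-> mul x y}.
Proof.
move=> x y; unlock mul; apply/eqmodP; rewrite /=.
by apply: mull_compat; rewrite equivl_sym; exact: repr_equiv.
Qed.
Canonical pi_mul_morph := PiMorph2 pi_mul.

Lemma pi_opp : {morph \pi : x / oppl x >-> opp x}.
Proof.
move=> x; unlock opp; apply/eqmodP; rewrite /=.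
by apply: oppl_compat; rewrite equivl_sym; exact: repr_equiv.
Qed.
Canonical pi_opp_morph := PiMorph1 pi_opp.

Ltac solve_eq := apply/eqmodP; rewrite /=; apply: equiv_of => /=; ring.

Lemma addA : associative add.
Proof. by elim/quotW=> x; elim/quotW=> y; elim/quotW=> z; rewrite !piE; solve_eq. Qed.
Lemma addC : commutative add.
Proof. by elim/quotW=> x; elim/quotW=> y; rewrite !piE; solve_eq. Qed.
Lemma add0 : left_id zero add.
Proof. by elim/quotW=> x; rewrite /zero !piE; solve_eq. Qed.
Lemma addN : left_inverse zero opp add.
Proof. by elim/quotW=> x; rewrite /zero !piE; solve_eq. Qed.

HB.instance Definition _ := GRing.isZmodule.Build type addA addC add0 addN.

Lemma mulA : associative mul.
Proof. by elim/quotW=> x; elim/quotW=> y; elim/quotW=> z; rewrite !piE; solve_eq. Qed.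
Lemma mulC : commutative mul.
Proof. by elim/quotW=> x; elim/quotW=> y; rewrite !piE; solve_eq. Qed.
Lemma mul1 : left_id one mul.
Proof. by elim/quotW=> x; rewrite /one !piE; solve_eq. Qed.
Lemma mulDl : left_distributive mul add.
Proof.
by elim/quotW=> x; elim/quotW=> y; elim/quotW=> z;
  rewrite !piE; solve_eq.
Qed.
Lemma one_neq0 : one != 0.
Proof.
apply/negP => /eqP /eqmodP /asbP [u [Su]] /=.
by rewrite !mulr1 subr0 mulr1 => hu; apply: S0; rewrite -hu.
Qed.

HB.instance Definition _ :=
  GRing.Zmodule_isComNzRing.Build type mulA mulC mul1 mulDl one_neq0.

Definition embed (a : A) : type := \pi_type (a, one_den).

End Loc.
End Loc.
HB.export Loc.

(* The faithfully flat extension S' = R[X_1..X_n]_{m R[X_1..X_n]}           *)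
Section Sprime.
Variables (R : comNzRingType) (M : R -> Prop) (n : nat).

(* g is not in m R[X] iff some coefficient of g is not in m *)
Definition notin_mS (g : {mpoly R[n]}) : Prop := ~ forall e, M g@_e.

Definition Sprime : comNzRingType := Loc.type notin_mS.

Definition to_Sprime (r : R) : Sprime := Loc.embed notin_mS r%:MP.
End Sprime.

Section Props.
Variables (R : comNzRingType) (M : R -> Prop).

Definition mfull (I : R -> Prop) :=
  (res_infinite M -> mfull_gen M I) /\
  (~ res_infinite M -> forall n, mu M n ->
     mfull_gen (ideal_ext (@to_Sprime R M n) M) (ideal_ext (@to_Sprime R M n) I)).

Definition full (I : R -> Prop) :=
  (res_infinite M -> full_gen M I) /\
  (~ res_infinite M -> forall n, mu M n ->
     full_gen (ideal_ext (@to_Sprime R M n) M) (ideal_ext (@to_Sprime R M n) I)).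
End Props.

Inductive fullness := MFull | WeaklyMFull | Full.

Definition has_prop (P : fullness) (R : comNzRingType) (M I : R -> Prop) :=
  match P with
  | MFull => mfull M I
  | WeaklyMFull => weakly_mfull M I
  | Full => full M I
  end.

(* Main.v *)
Require Import Defs.
From HB Require Import structures.
From mathcomp Require Import all_boot all_order all_algebra.
From mathcomp Require Import generic_quotient ring zify mpoly.
From Stdlib Require Import Classical IndefiniteDescription.
From Stdlib Require Import FunctionalExtensionality PropExtensionality.

(* Both general properties have the form "I : x = L for general x", where
   mL <= I <= L: take (I, L) = (mJ, J) for m-fullness and (J, J : m) for
   fullness.  Replacing J by J + K m^n replaces (I, L), for n large and up to a
   shift, by (I + K m^(n+1), L + K m^n); for fullness, as for weak m-fullness,
   this rests on (I + K m^(n+1)) : m = (I : m) + K m^n for n large.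
   A general x annihilates modulo I only elements annihilated by a power of m,
   so I : x is contained in L as soon as (I : x) /\ (L : m) is.
   Descent then follows from Artin-Rees in the form (L : m) /\ m^n <= m (L : m).
   For the lifting, write an element of (L + K m^(n+1)) : m as s + t with s in
   L : m and t in K m^n.  If x multiplies it into I + K m^(n+2), then Artin-Rees
   separates the two summands: sx is in I, so s is in L, while tx is in
   I + K m^(n+2), so t is in I + K m^(n+1) because x is superficial.
   Superficial elements come from Noetherian induction on graded submodules of
   the Rees algebra.  No infinite residue field is needed, so the argument
   applies verbatim to S', which is again Noetherian local. *)

Set Implicit Arguments.
Unset Strict Implicit.
Unset Printing Implicit Defensive.

Import GRing.Theory.
Local Open Scope ring_scope.
Local Open Scope quotient_scope.

(** * Ideals *)

Section IdealTheory.
Variable T : comNzRingType.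
Implicit Types (I J A B M : T -> Prop) (s : seq T).

(** Encoded by its universal property: membership is used by exhibiting a suitable ideal, with no
    bookkeeping of coefficients. *)
Definition ideal_hull s : T -> Prop :=
  fun z => forall A, is_ideal A -> (forall x, x \in s -> A x) -> A z.

Lemma ideal0 I : is_ideal I -> I 0. Proof. by case. Qed.
Lemma idealD I x y : is_ideal I -> I x -> I y -> I (x + y).
Proof. by case=> _ h _; exact: h. Qed.
Lemma idealM I r x : is_ideal I -> I x -> I (r * x).
Proof. by case=> _ _; exact. Qed.
Lemma ideal_mulr I r x : is_ideal I -> I x -> I (x * r).
Proof. by move=> hI; rewrite mulrC; exact: idealM. Qed.
Lemma idealN I x : is_ideal I -> I x -> I (- x).
Proof. by move=> hI hx; rewrite -mulN1r; exact: idealM. Qed.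
Lemma idealB I x y : is_ideal I -> I x -> I y -> I (x - y).
Proof. by move=> hI hx /(idealN hI); exact: idealD. Qed.
Lemma ideal_big_sum I (U : Type) (r : seq U) (P : pred U) (F : U -> T) :
  is_ideal I -> (forall i, P i -> I (F i)) -> I (\sum_(i <- r | P i) F i).
Proof. by case=> h0 hD _ hF; apply: (big_ind I). Qed.

Lemma is_ideal_top : is_ideal (fun _ : T => True). Proof. by []. Qed.

Lemma is_idealI A B : is_ideal A -> is_ideal B -> is_ideal (fun z => A z /\ B z).
Proof.
move=> [a0 aD aM] [b0 bD bM]; split=> //.
  by move=> x y [? ?] [? ?]; split; [exact: aD | exact: bD].
by move=> r x [? ?]; split; [exact: aM | exact: bM].
Qed.

Lemma is_ideal_generated k (g : 'I_k -> T) : is_ideal (generated_by g).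
Proof.
split.
- by exists (fun=> 0); rewrite big1 // => i _; rewrite mul0r.
- move=> x y [c ->] [d ->]; exists (fun i => c i + d i).
  by rewrite -big_split; apply: eq_bigr => i _; rewrite mulrDl.
- move=> r x [c ->]; exists (fun i => r * c i).
  by rewrite mulr_sumr; apply: eq_bigr => i _; rewrite mulrA.
Qed.

Lemma generated_mem k (g : 'I_k -> T) i : generated_by g (g i).
Proof.
exists (fun j => (j == i)%:R); rewrite (bigD1 i) //= eqxx mul1r big1 ?addr0 //.
by move=> j /negbTE->; rewrite mul0r.
Qed.

Lemma generated_ind k (g : 'I_k -> T) A :
  is_ideal A -> (forall i, A (g i)) -> forall z, generated_by g z -> A z.
Proof. by move=> hA hg z [c ->]; apply: ideal_big_sum => // i _; apply: idealM. Qed.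

Lemma noetherian_hull : noetherian T -> forall I, is_ideal I ->
  exists s, (forall x, x \in s -> I x) /\ (forall z, I z -> ideal_hull s z).
Proof.
move=> nT I /nT[k [g hg]].
exists (codom g); split=> [x /codomP[i ->]|z /hg hz A hA hs].
  by apply/hg; apply: generated_mem.
by apply: generated_ind hz => // i; apply/hs/codom_f.
Qed.

Lemma noetherian_of_hull :
  (forall I, is_ideal I ->
    exists s, (forall x, x \in s -> I x) /\ (forall z, I z -> ideal_hull s z)) ->
  noetherian T.
Proof.
move=> h I hI; have [s [sI Is]] := h I hI.
exists (size s), (tnth (in_tuple s)) => z; split.
  move/Is; apply; first exact: is_ideal_generated.
  by move=> x /(tnthP (in_tuple s))[i ->]; exact: generated_mem.
by apply: generated_ind => // i; apply: sI; apply: mem_tnth.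
Qed.

(** Dependent choice would otherwise give a strictly increasing chain in [F]; its union is finitely
    generated, so all generators lie in one term and the chain stops there. *)
Lemma noetherian_max (F : (T -> Prop) -> Prop) I0 :
  noetherian T -> (forall I, F I -> is_ideal I) -> F I0 ->
  exists I, F I /\ forall I', F I' -> (forall z, I z -> I' z) ->
    forall z, I' z -> I z.
Proof.
move=> nT FI F0; apply: NNPP => nomax.
have step (X : {I | F I}) : {Y : {I | F I} | (forall z, sval X z -> sval Y z) /\
    ~ forall z, sval Y z -> sval X z}.
  apply: constructive_indefinite_description.
  apply: NNPP => hI; apply: nomax; exists (sval X); split; first exact: svalP.
  move=> I' FI' II'; apply: NNPP => h; apply: hI.
  by exists (exist _ I' FI').
pose c n := iter n (fun X => sval (step X)) (exist F I0 F0).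
have cS n z : sval (c n) z -> sval (c n.+1) z by case: (svalP (step (c n))) => + _; apply.
have cle n m z : (n <= m)%N -> sval (c n) z -> sval (c m) z.
  by move=> /subnK<- hz; elim: (m - n)%N => // k IH; rewrite addSn; apply: cS.
have cI n : is_ideal (sval (c n)) by apply/FI/svalP.
have uI : is_ideal (fun z => exists n, sval (c n) z).
  split; first by exists 0%N; apply: ideal0.
    move=> x y [n hx] [m hy]; exists (maxn n m); apply: idealD => //.
      by apply: cle hx; apply: leq_maxl.
    by apply: cle hy; apply: leq_maxr.
  by move=> r x [n hx]; exists n; apply: idealM.
have [s [sU Us]] := noetherian_hull nT uI.
have [n hn] : exists n, forall x, x \in s -> sval (c n) x.
  elim: s sU {Us} => [|x s IH] sU; first by exists 0%N.
  have [n hn] := IH (fun y hy => sU y (mem_behead (s := x :: s) hy)).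
  have [m hm] := sU x (mem_head _ _).
  exists (maxn n m) => y; rewrite inE => /orP[/eqP->|/hn hy].
    by apply: cle hm; apply: leq_maxr.
  by apply: cle hy; apply: leq_maxl.
case: (svalP (step (c n))) => _; apply => z hz.
by apply: (Us z) => //; exists n.+1.
Qed.

Lemma is_ideal_mul I J : is_ideal J -> is_ideal (ideal_mul I J).
Proof.
move=> hJ; split.
- by exists 0%N, (fun=> 0), (fun=> 0); split=> [[]|[]|] //; rewrite big_ord0.
- move=> _ _ [k [a [b [ha hb ->]]]] [l [c [d [hc hd ->]]]].
  exists (k + l)%N, (fun i => match split i with inl i => a i | inr i => c i end),
    (fun i => match split i with inl i => b i | inr i => d i end).
  split; [by move=> i; case: split | by move=> i; case: split |].
  rewrite big_split_ord /=; congr (_ + _); apply: eq_bigr => i _.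
    by have := unsplitK (inl i : 'I_k + 'I_l)%type => /= ->.
  by have := unsplitK (inr i : 'I_k + 'I_l)%type => /= ->.
- move=> r _ [k [a [b [ha hb ->]]]]; exists k, a, (fun i => r * b i); split=> //.
    by move=> i; apply: idealM.
  by rewrite mulr_sumr; apply: eq_bigr => i _; rewrite mulrCA.
Qed.

Lemma ideal_mul_mem I J x y : I x -> J y -> ideal_mul I J (x * y).
Proof. by exists 1%N, (fun=> x), (fun=> y); rewrite big_ord1. Qed.

Lemma ideal_mul_ind I J A : is_ideal A -> (forall x y, I x -> J y -> A (x * y)) ->
  forall z, ideal_mul I J z -> A z.
Proof.
by move=> hA h _ [k [a [b [ha hb ->]]]]; apply: ideal_big_sum => // i _; apply: h.
Qed.

Lemma is_ideal_sum I J : is_ideal I -> is_ideal J -> is_ideal (ideal_sum I J).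
Proof.
move=> hI hJ; split.
- by exists 0, 0; rewrite addr0; split=> //; apply: ideal0.
- move=> _ _ [x [y [hx hy ->]]] [x' [y' [hx' hy' ->]]].
  by exists (x + x'), (y + y'); split; [exact: idealD | exact: idealD | ring].
- move=> r _ [x [y [hx hy ->]]]; exists (r * x), (r * y).
  by split; [exact: idealM | exact: idealM | ring].
Qed.

Lemma ideal_sumL I J x : is_ideal J -> I x -> ideal_sum I J x.
Proof. by move=> hJ hx; exists x, 0; rewrite addr0; split=> //; apply: ideal0. Qed.

Lemma ideal_sumR I J x : is_ideal I -> J x -> ideal_sum I J x.
Proof. by move=> hJ hx; exists 0, x; rewrite add0r; split=> //; apply: ideal0. Qed.

Lemma is_ideal_colon I J : is_ideal I -> is_ideal (colon I J).
Proof.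
move=> hI; split.
- by move=> y _; rewrite mul0r; apply: ideal0.
- by move=> x y hx hy z hz; rewrite mulrDl; apply: idealD => //; [apply: hx | apply: hy].
- by move=> r x hx z hz; rewrite -mulrA; apply: idealM => //; apply: hx.
Qed.

Lemma is_ideal_pow M n : is_ideal M -> is_ideal (ideal_pow M n).
Proof. by case: n => [|n] hM /=; [exact: is_ideal_top | exact: is_ideal_mul]. Qed.

Lemma ideal_pow1 M x : M x -> ideal_pow M 1 x.
Proof. by move=> hx; rewrite -[x]mul1r; apply: (ideal_mul_mem (I := fun=> True)). Qed.

Lemma ideal_powD M a b x y : is_ideal M ->
  ideal_pow M a x -> ideal_pow M b y -> ideal_pow M (a + b) (x * y).
Proof.
move=> hM hx; elim: b y => [|b IH] y /=.
  by move=> _; rewrite addn0; apply: ideal_mulr => //; apply: is_ideal_pow.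
rewrite addnS; move: y.
apply: (ideal_mul_ind (A := fun y => ideal_pow M (a + b).+1 (x * y))).
  have hP : is_ideal (ideal_pow M (a + b).+1) by apply: is_ideal_pow.
  split; first by rewrite mulr0; apply: ideal0.
    by move=> u v; rewrite mulrDr; apply: idealD.
  by move=> r u; rewrite mulrCA; apply: idealM.
by move=> u v hu hv; rewrite mulrA; apply: ideal_mul_mem => //; apply: IH.
Qed.

Lemma ideal_pow_le M a b x : is_ideal M -> (a <= b)%N ->
  ideal_pow M b x -> ideal_pow M a x.
Proof.
move=> hM /subnK<-; elim: (b - a)%N x => // k IH; rewrite addSn /=.
apply: ideal_mul_ind; first exact: is_ideal_pow.
by move=> u v hu _; apply: ideal_mulr; [exact: is_ideal_pow | exact: IH].
Qed.

End IdealTheory.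

Lemma is_ideal_preim (A B : comNzRingType) (phi : {rmorphism A -> B}) (J : B -> Prop) :
  is_ideal J -> is_ideal (fun a => J (phi a)).
Proof.
move=> hJ; split; first by rewrite rmorph0; apply: ideal0.
  by move=> x y hx hy; rewrite rmorphD; apply: idealD.
by move=> r x hx; rewrite rmorphM; apply: idealM.
Qed.

(** * Hilbert's basis theorem *)

Lemma noetherian_surj (A B : comNzRingType) (phi : {rmorphism A -> B}) :
  (forall y, exists x, y = phi x) -> noetherian A -> noetherian B.
Proof.
move=> surj nA; apply: noetherian_of_hull => I hI.
have pre := @is_ideal_preim _ _ phi.
have [s [sI Is]] := noetherian_hull nA (pre I hI).
exists (map phi s); split=> [_ /mapP[x /sI hx ->] //|y].
have [x ->] := surj y => hx J hJ hs.
by apply: (Is x hx _ (pre J hJ)) => z hz; apply/hs/map_f.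
Qed.

Section HilbertBasis.
Variable A : comNzRingType.
Implicit Types (I J : {poly A} -> Prop).

Definition lead_ideal I n : A -> Prop :=
  fun c => exists p, [/\ I p, (size p <= n.+1)%N & p`_n = c].

Lemma is_ideal_lead I n : is_ideal I -> is_ideal (lead_ideal I n).
Proof.
move=> hI; split.
- by exists 0; rewrite size_poly0 coef0; split=> //; apply: ideal0.
- move=> _ _ [p [hp sp <-]] [q [hq sq <-]]; exists (p + q).
  rewrite coefD; split=> //; first exact: idealD.
  by rewrite (leq_trans (size_polyD _ _)) // geq_max sp.
- move=> r _ [p [hp sp <-]]; exists (r%:P * p); rewrite coefCM; split=> //.
    exact: idealM.
  by rewrite mul_polyC (leq_trans (size_scale_leq _ _)).
Qed.

Lemma lead_ideal_le I m n c : is_ideal I -> (m <= n)%N ->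
  lead_ideal I m c -> lead_ideal I n c.
Proof.
move=> hI /subnK<-; set k := (n - m)%N => -[p [hp sp <-]].
exists (p * 'X^k); rewrite coefMXn ltnNge leq_addr /= addKn; split=> //.
  exact: ideal_mulr.
by rewrite (leq_trans (size_polyMleq _ _)) // size_polyXn addnS /= addnC -addnS leq_add2l.
Qed.

(** Any [J] containing the finitely many witnesses inherits the leading coefficients in [s]. The
    predicate [P] records the degree: trivial for the union of all lead ideals, exact for a single
    one. *)
Lemma lead_witnesses I (P : A -> nat -> Prop) (s : seq A) :
  (forall c, c \in s -> exists n, P c n /\ lead_ideal I n c) ->
  exists ps : seq {poly A}, (forall p, p \in ps -> I p) /\
    exists D, forall J, (forall p, p \in ps -> J p) -> forall c, c \in s ->
      exists n, [/\ (n <= D)%N, P c n & lead_ideal J n c].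
Proof.
elim: s => [|c s IH] h; first by exists [::]; split=> //; exists 0%N.
have [ps [psI [D hD]]] := IH (fun d hd => h d (mem_behead (s := c :: s) hd)).
have [n [Pn [p [Ip sp pc]]]] := h c (mem_head _ _).
exists (p :: ps); split; first by move=> q; rewrite inE => /orP[/eqP->|/psI].
exists (maxn n D) => J hJ d; rewrite inE => /orP[/eqP->|hd].
  exists n; split=> //; first exact: leq_maxl.
  by exists p; split=> //; apply: hJ; apply: mem_head.
have [q hq|k [kD Pk Jk]] := hD J _ d hd; first by apply: hJ; rewrite inE hq orbT.
by exists k; split=> //; rewrite leq_max kD orbT.
Qed.

Lemma noetherian_poly : noetherian A -> noetherian {poly A}.
Proof.
move=> nA; apply: noetherian_of_hull => I hI.
have hL : is_ideal (fun c => exists n, lead_ideal I n c).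
  split; first by exists 0%N; exact: (ideal0 (is_ideal_lead 0 hI)).
    move=> x y [n hx] [m hy]; exists (maxn n m).
    apply: idealD; first exact: is_ideal_lead.
      by apply: lead_ideal_le hx => //; apply: leq_maxl.
    by apply: lead_ideal_le hy => //; apply: leq_maxr.
  by move=> r x [n hx]; exists n; apply: idealM => //; apply: is_ideal_lead.
have [s [sL Ls]] := noetherian_hull nA hL.
(* [ps] accounts for the leading coefficients in degrees at least [D], and [qs] below for the
   finitely many smaller degrees. *)
have [ps [psI [D hD]]] : exists ps : seq {poly A}, (forall p, p \in ps -> I p) /\
    exists D, forall J, (forall p, p \in ps -> J p) -> forall c, c \in s ->
      exists n, [/\ (n <= D)%N, True & lead_ideal J n c].
  by apply: lead_witnesses => c /sL[n hn]; exists n.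
have [qs [qsI hqs]] : exists qs : seq {poly A}, (forall p, p \in qs -> I p) /\
    forall J, is_ideal J -> (forall p, p \in qs -> J p) ->
    forall n, (n < D)%N -> forall c, lead_ideal I n c -> lead_ideal J n c.
  elim: (D) => [|k [qs [qsI IH]]]; first by exists [::].
  have [t [tL Lt]] := noetherian_hull nA (is_ideal_lead k hI).
  have [rs [rsI [E hE]]] : exists rs : seq {poly A}, (forall p, p \in rs -> I p) /\
    exists E, forall J, (forall p, p \in rs -> J p) -> forall c, c \in t ->
      exists n, [/\ (n <= E)%N, n = k & lead_ideal J n c].
    by apply: lead_witnesses => c /tL hc; exists k.
  exists (rs ++ qs); split; first by move=> p; rewrite mem_cat => /orP[/rsI|/qsI].
  move=> J hJ hs n; rewrite ltnS leq_eqVlt => /orP[/eqP->|nk] c.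
    move=> /Lt; apply; first exact: is_ideal_lead.
    move=> d dt; have [p hp|m [_ -> //]] := hE J _ d dt.
    by apply: hs; rewrite mem_cat hp.
  by apply: IH => // p hp; apply: hs; rewrite mem_cat hp orbT.
exists (ps ++ qs); split; first by move=> p; rewrite mem_cat => /orP[/psI|/qsI].
move=> p Ip J hJ hs.
(* The polynomial cancelling the top coefficient of [p] is taken in both ideals: in [J] for the
   conclusion, in [I] so that the difference stays in [I] and the induction on the size
   continues. *)
pose IJ p := I p /\ J p.
have hIJ : is_ideal IJ by apply: is_idealI.
have IJs q : q \in ps ++ qs -> IJ q.
  by move=> hq; split; [move: hq; rewrite mem_cat => /orP[/psI|/qsI] | exact: hs].
have lead n c : lead_ideal I n c -> lead_ideal IJ n c.
  have [nD|Dn] := ltnP n D.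
    by apply: hqs => // q hq; apply: IJs; rewrite mem_cat hq orbT.
  move=> hc; apply: (Ls c); [by exists n | exact: is_ideal_lead |].
  move=> d ds; have [q hq|m [mD _]] := hD IJ _ d ds.
    by apply: IJs; rewrite mem_cat hq.
  by apply: lead_ideal_le => //; apply: leq_trans mD Dn.
have [n] : exists n, (size p <= n)%N by exists (size p).
elim: n p Ip => [|n IH] p Ip sp.
  by move: sp; rewrite leqn0 size_poly_eq0 => /eqP->; apply: ideal0.
have [|q [[Iq Jq] sq qn]] := lead n p`_n; first by exists p.
rewrite -[p](subrK q); apply: idealD => //; apply: IH; first exact: idealB.
apply/leq_sizeP => j; rewrite leq_eqVlt coefB => /orP[/eqP<-|nj].
  by rewrite qn subrr.
by rewrite !nth_default ?subrr // (leq_trans _ nj).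
Qed.

End HilbertBasis.

(** The ring in [n.+1] variables is an image of the univariate polynomial ring over that in [n]
    variables. *)
Lemma noetherian_mpoly (A : comNzRingType) n : noetherian A -> noetherian {mpoly A[n]}.
Proof.
move=> nA; elim: n => [|n IH].
  apply: (noetherian_surj (phi := @mpolyC 0 A)) nA => p.
  exists p@_0; apply/mpolyP => m; rewrite mcoeffC.
  have -> : m = 0%MM by apply/mnmP; case.
  by rewrite eqxx mulr1.
pose X : {mpoly A[n.+1]} := 'X_ord_max.
have comX : commr_rmorph (@mwiden n A) X by move=> p; apply: mulrC.
apply: (noetherian_surj (phi := horner_morph comX)) (noetherian_poly IH) => p.
elim/mpolyind: p => [|c m p _ _ [q ->]]; first by exists 0; rewrite rmorph0.
exists (c%:MP%:P * \prod_(i < n) ('X_i)%:P ^+ m (widen_ord (leqnSn n) i) * 'X ^+ m ord_max + q).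
rewrite rmorphD; congr (_ + _).
rewrite !rmorphM !rmorphXn rmorph_prod /= horner_morphC horner_morphX.
rewrite /= mwidenC mul_mpolyC -scalerAl; congr (_ *: _).
rewrite mpolyXE_id big_ord_recr /=; congr (_ * _); apply: eq_bigr => i _.
by rewrite rmorphXn /= horner_morphC /= mwidenX mnmwiden1.
Qed.

(** * The Rees algebra and Artin-Rees *)

Section Rees.
Variables (R : comNzRingType) (M : R -> Prop) (d : nat) (g : 'I_d -> R).
Hypotheses (nR : noetherian R) (Mg : ideal_eq M (generated_by g)).
Implicit Types (N : nat -> R -> Prop).
Let Mid : is_ideal M.
Proof.
have [h0 hD hM] := is_ideal_generated g.
split; first by apply/Mg.
  by move=> x y /Mg hx /Mg hy; apply/Mg/hD.
by move=> r x /Mg hx; apply/Mg/hM.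
Qed.
Let Mgi i : M (g i). Proof. by apply/Mg; apply: generated_mem. Qed.
Let powI n : is_ideal (ideal_pow M n). Proof. exact: is_ideal_pow. Qed.

(** The homogeneous components of a graded ideal of the Rees algebra R[Mt], with [N n] t^n in degree
    n. *)
Definition rees_seq N :=
  [/\ forall n, is_ideal (N n), forall n z, N n z -> ideal_pow M n z &
      forall n x z, M x -> N n z -> N n.+1 (x * z)].

Lemma rees_powM N a b x z : rees_seq N ->
  ideal_pow M a x -> N b z -> N (a + b)%N (x * z).
Proof.
move=> [NI _ NM]; elim: a b x z => [|a IH] b x z /=.
  by move=> _ hz; apply: idealM.
move=> + hz; move: x.
apply: (ideal_mul_ind (A := fun x => N (a.+1 + b)%N (x * z))).
  split; first by rewrite mul0r; apply: ideal0.
    by move=> u v; rewrite mulrDl; apply: idealD.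
  by move=> r u; rewrite -mulrA; apply: idealM.
move=> u v hu hv; rewrite -mulrA addSnnS; apply: IH => //; exact: NM.
Qed.

(* The image of rees_map is the Rees algebra R[Mt]. *)
Definition rees_map : {mpoly R[d]} -> {poly R} :=
  mmap (@polyC R) (fun i => (g i)%:P * 'X).
HB.instance Definition _ := GRing.RMorphism.on rees_map.

Lemma rees_map_coef p n : ideal_pow M n (rees_map p)`_n.
Proof.
pose W (q : {poly R}) := forall n, ideal_pow M n q`_n.
have WD q r : W q -> W r -> W (q + r) by move=> hq hr k; rewrite coefD; apply: idealD.
have WM q r : W q -> W r -> W (q * r).
  move=> hq hr k; rewrite coefM; apply: ideal_big_sum => // i _.
  have {1}-> : k = (i + (k - i))%N by rewrite subnKC // -ltnS.
  exact: ideal_powD.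
have WC c : W c%:P by move=> k; rewrite coefC; case: k => [|k] //; apply: ideal0.
suff : W (rees_map p) by apply.
rewrite /rees_map /mmap; apply: (big_ind W) => // [|m _]; first exact: WC.
apply: (WM) => //; apply: (big_ind W) => // [|i _]; first exact: WC.
elim: (m i) => [|k IH]; first exact: WC.
rewrite exprS; apply: (WM) => // l; rewrite coefCM coefX.
case: eqP => [->|_]; last by rewrite mulr0; apply: ideal0.
by rewrite mulr1; apply: ideal_pow1.
Qed.

Lemma rees_map_surj n y : ideal_pow M n y -> exists p, rees_map p = y%:P * 'X^n.
Proof.
have hA k : is_ideal (fun y => exists p, rees_map p = y%:P * 'X^k).
  split; first by exists 0; rewrite rmorph0 mul0r.
    by move=> u v [p hp] [q hq]; exists (p + q); rewrite rmorphD /= hp hq polyCD mulrDl.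
  move=> r u [p hp]; exists (r%:MP * p).
  by rewrite rmorphM /= hp /rees_map mmapC polyCM mulrA.
elim: n y => [|n IH] y /=.
  by move=> _; exists y%:MP; rewrite /rees_map mmapC mulr1.
move: y; apply: ideal_mul_ind => // u v /IH[p hp] /Mg hv.
have [q hq] : exists p, rees_map p = v%:P * 'X^1.
  apply: (generated_ind (hA 1%N) _ hv) => i; exists 'X_i.
  by rewrite /rees_map mmapX mmap1U.
by exists (p * q); rewrite rmorphM /= hp hq polyCM mulrACA -exprSr.
Qed.

(** Pulling the graded ideal back to R[X_1..X_d] makes Hilbert's basis theorem available for it. *)
Definition rees_ideal N : {mpoly R[d]} -> Prop := fun p => forall n, N n (rees_map p)`_n.

Lemma is_ideal_rees N : rees_seq N -> is_ideal (rees_ideal N).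
Proof.
move=> rN; have [NI _ NM] := rN; split.
- by move=> n; rewrite rmorph0 coef0; apply: ideal0.
- by move=> p q hp hq n; rewrite rmorphD /= coefD; apply: idealD.
- move=> r p hp n; rewrite rmorphM /= coefM; apply: ideal_big_sum => // i _.
  have {1}-> : n = (i + (n - i))%N by rewrite subnKC // -ltnS.
  by apply: rees_powM => //; apply: rees_map_coef.
Qed.

Lemma rees_ideal_mono N n z p : rees_seq N -> rees_map p = z%:P * 'X^n ->
  (rees_ideal N p <-> N n z).
Proof.
move=> [NI _ _] hp; split=> [/(_ n)|hz k]; rewrite hp coefCM coefXn.
  by rewrite eqxx mulr1.
by case: eqP => [->|_]; rewrite ?mulr1 // mulr0; apply: ideal0.
Qed.

(** Beyond the degrees of finitely many generators, a homogeneous element is a combination with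
    coefficients of positive degree, and each of these contributes a factor in [M]. *)
Lemma rees_stable N : rees_seq N ->
  exists c, forall n, (c <= n)%N -> forall z, N n.+1 z -> ideal_mul (N n) M z.
Proof.
move=> rN; have [NI NP NM] := rN.
have [s [sN Ns]] := noetherian_hull (noetherian_mpoly nR) (is_ideal_rees rN).
exists (\max_(p <- s) size (rees_map p)) => n hn z hz.
have [p hp] := rees_map_surj (NP _ _ hz).
have Ip : rees_ideal N p by apply/(rees_ideal_mono rN hp).
have mulI : is_ideal (ideal_mul (N n) M) by apply: is_ideal_mul.
pose A q := rees_ideal N q /\ ideal_mul (N n) M (rees_map q)`_n.+1.
suff [_] : A p by rewrite hp coefCM coefXn eqxx mulr1.
apply: (Ns p Ip); last first.
  move=> q qs; split; first exact: sN.
  rewrite nth_default; first exact: ideal0.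
  apply: leq_trans (leqW hn).
  exact: (leq_bigmax_seq _ qs).
have reesI := is_ideal_rees rN.
split; first by split; [exact: ideal0 | rewrite rmorph0 coef0; exact: ideal0].
  move=> u v [? ?] [? ?]; split; first exact: (idealD reesI).
  by rewrite rmorphD /= coefD; apply: (idealD mulI).
move=> r u [hu hu']; split; first exact: (idealM _ reesI).
(* The term with the constant coefficient of r falls under the hypothesis on u; in every other term,
   M^(i+1) is M^i M and [N] absorbs M^i. *)
rewrite rmorphM /= coefM; apply: (ideal_big_sum _ mulI) => -[[|i] /= hi] _.
  by rewrite subn0; apply: (idealM _ mulI).
have := rees_map_coef r i.+1; rewrite subSS.
set x := (rees_map r)`_i.+1; move: x => /=.
apply: (ideal_mul_ind (A := fun x => ideal_mul (N n) M (x * (rees_map u)`_(n - i)))).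
  split; first by rewrite mul0r; apply: ideal0.
    by move=> a b; rewrite mulrDl; apply: (idealD mulI).
  by move=> a b; rewrite -mulrA; apply: (idealM _ mulI).
move=> a b ha hb; rewrite mulrAC; apply: ideal_mul_mem => //.
have {1}-> : n = (i + (n - i))%N by rewrite subnKC // -ltnS.
by apply: rees_powM => //; apply: hu.
Qed.

(** [rees_ideal] preserves and reflects inclusions, so maximal members can be found in
    R[X_1..X_d]. *)
Lemma rees_max (F : (nat -> R -> Prop) -> Prop) N0 :
  (forall N, F N -> rees_seq N) -> F N0 ->
  exists N, F N /\ forall N', F N' -> (forall n z, N n z -> N' n z) ->
    forall n z, N' n z -> N n z.
Proof.
move=> rF F0.
have [||_ [[N [FN ->]] hN]] := @noetherian_max _
  (fun I => exists N, F N /\ I = rees_ideal N) (rees_ideal N0) (noetherian_mpoly nR).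
- by move=> _ [N [/rF rN ->]]; apply: is_ideal_rees.
- by exists N0.
exists N; split=> // N' FN' sub n z hz.
have rN := rF _ FN; have rN' := rF _ FN'.
have [p hp] : exists p, rees_map p = z%:P * 'X^n.
  by apply: rees_map_surj; case: rN' => _ h _; apply: h.
apply/(rees_ideal_mono rN hp); apply: (hN (rees_ideal N')); first by exists N'.
  by move=> q hq k; apply/sub/hq.
by apply/(rees_ideal_mono rN' hp).
Qed.

(** Stability of the graded ideal whose degree n component is the intersection of [A] with M^n. *)
Lemma artin_rees_mul A : is_ideal A ->
  exists c, forall n, (c <= n)%N -> forall z, A z -> ideal_pow M n z -> ideal_mul A M z.
Proof.
move=> hA.
have [|c hc] := @rees_stable (fun n z => A z /\ ideal_pow M n z).
  split=> [n|n z []//|n x z hx [hz hz']]; first exact: is_idealI.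
  by split; [exact: idealM | rewrite mulrC; exact: ideal_mul_mem].
exists c.+1 => -[//|n] hn z Az Mz.
apply: ideal_mul_ind (hc n hn z (conj Az Mz)); first exact: is_ideal_mul.
by move=> x y [hx _]; apply: ideal_mul_mem.
Qed.

End Rees.

(** * General and superficial elements *)

Section Coefficients.
Variables (R : comNzRingType) (d : nat).
Implicit Types (A B : R -> Prop) (p q : {mpoly R[d]}).

Definition coefs_in A p := forall e, A p@_e.

Lemma is_ideal_coefs A : is_ideal A -> is_ideal (coefs_in A).
Proof.
move=> hA; split.
- by move=> e; rewrite mcoeff0; apply: ideal0.
- by move=> p q hp hq e; rewrite mcoeffD; apply: idealD.
- by move=> p q hq e; rewrite mcoeffM; apply: ideal_big_sum => // i _; apply: idealM.
Qed.

Lemma coefs_in_mul A B p q : is_ideal B -> coefs_in A p -> coefs_in B q ->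
  coefs_in (ideal_mul A B) (p * q).
Proof.
move=> hB hp hq e; rewrite mcoeffM; apply: ideal_big_sum; first exact: is_ideal_mul.
by move=> i _; apply: ideal_mul_mem.
Qed.

Lemma coefs_in_X A c m : is_ideal A -> A c -> coefs_in A (c *: 'X_[m]).
Proof. by move=> hA hc e; rewrite mcoeffZ; apply: ideal_mulr. Qed.

Lemma coefs_inS A B p : (forall x, A x -> B x) -> coefs_in A p -> coefs_in B p.
Proof. by move=> AB hp e; apply/AB/hp. Qed.

(** The coefficient of X_i is the constant term of the i-th partial derivative, so this is the
    Leibniz rule at the origin. *)
Lemma mcoeffUM p q i : p@_0 = 0 -> (p * q)@_U_(i) = p@_U_(i) * q@_0.
Proof.
have deriv r : r@_U_(i) = (r^`M(i))@_0 by rewrite mcoeff_deriv add0m mnm0E mulr1n.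
by move=> p0; rewrite !deriv mderivM mcoeffD !rmorphM /= p0 mul0r addr0.
Qed.

Variable M : R -> Prop.
Hypothesis locM : is_local M.

Lemma local_prime x y : ~ M x -> ~ M y -> ~ M (x * y).
Proof.
have [Mid _ inv] := locM => /inv[z xz] hy hxy; apply: hy.
by rewrite -[y]mul1r -xz mulrAC; apply: ideal_mulr.
Qed.

Definition nontrivial_mod p := exists e, ~ M p@_e.

(** Dropping all terms with coefficient in [M] changes [p] only modulo [M] and leaves a nonzero
    polynomial. *)
Lemma nontrivial_lead p : nontrivial_mod p ->
  exists q, coefs_in M (p - q) /\ ~ M (mleadc q).
Proof.
have [Mid _ _] := locM => -[e0 he0].
pose q := \sum_(m <- msupp p) (if asb (M p@_m) then 0 else p@_m) *: 'X_[m].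
have qe e : q@_e = if asb (M p@_e) then 0 else p@_e.
  rewrite /q raddf_sum /=.
  have [es|es] := boolP (e \in msupp p).
    rewrite (bigD1_seq e) ?msupp_uniq //= mcoeffZ mcoeffX eqxx mulr1 big1 ?addr0 //.
    by move=> m /negbTE ne; rewrite mcoeffZ mcoeffX ne mulr0.
  rewrite (memN_msupp_eq0 es) if_same big_seq big1 // => m ms.
  rewrite mcoeffZ mcoeffX; case: eqP => [em|_]; last by rewrite mulr0.
  by rewrite -em ms in es.
exists q; split=> [e|].
  by rewrite mcoeffB qe; case: asbP => h; rewrite ?subr0 ?subrr //; apply: ideal0.
have : q != 0.
  apply/eqP => q0; have := qe e0; rewrite q0 mcoeff0.
  by case: asbP => // _ /esym p0; apply: he0; rewrite p0; apply: ideal0.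
by rewrite -mleadc_eq0 qe; case: asbP => //; rewrite eqxx.
Qed.

(** Gauss's lemma, by multiplying leading coefficients outside the prime [M]. It allows finitely
    many nonempty open conditions to be imposed at once. *)
Lemma nontrivial_mul p q : nontrivial_mod p -> nontrivial_mod q ->
  nontrivial_mod (p * q).
Proof.
have [Mid _ _] := locM; have cI := is_ideal_coefs Mid.
move=> /nontrivial_lead[p' [hp lp]] /nontrivial_lead[q' [hq lq]].
exists (mlead p' + mlead q')%MM => h; apply: (local_prime lp lq).
rewrite -mleadcM.
have -> : p' * q' = p * q - (p * (q - q') + q' * (p - p')) by ring.
rewrite mcoeffB; apply: idealB => //.
by apply: (idealD cI); apply: (idealM _ cI).
Qed.

End Coefficients.

Section Superficial.
Variables (R : comNzRingType) (M : R -> Prop) (d : nat) (g : 'I_d -> R).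
Hypotheses (nR : noetherian R) (locM : is_local M) (Mg : ideal_eq M (generated_by g)).
Implicit Types (A I J K : R -> Prop) (N : nat -> R -> Prop).
Let Mid : is_ideal M. Proof. by case: locM. Qed.
Let Mgi i : M (g i). Proof. by apply/Mg; apply: generated_mem. Qed.
Let powI n : is_ideal (ideal_pow M n). Proof. exact: is_ideal_pow. Qed.

Let lin (a : 'I_d -> R) := \sum_(i < d) a i * g i.
Let Mlin a : M (lin a).
Proof. by apply: ideal_big_sum => // i _; apply: idealM. Qed.

(** If M^n is the least power killing r modulo [A], some s in M^(n-1) gives a nonzero class of s r,
    which [M] kills. *)
Lemma socle_elt A n r : is_ideal A -> ~ A r ->
  (forall y, ideal_pow M n y -> A (y * r)) ->
  exists s, ~ A (s * r) /\ forall y, M y -> A (y * (s * r)).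
Proof.
move=> hA hr; elim: n => [|n IH] h.
  by case: hr; rewrite -[r]mul1r; apply: h.
have [/IH//|/not_all_ex_not[y hy]] :=
  classic (forall y, ideal_pow M n y -> A (y * r)).
have [My Ay] := imply_to_and _ _ hy.
by exists y; split=> // z Mz; rewrite mulrA; apply: h; rewrite mulrC; apply: ideal_mul_mem.
Qed.

(* A maximal ideal H among those containing A but not M gives M/H of length
   one, hence a linear form computing the class of [lin a] in M/H. *)
Lemma general_notin A : is_ideal A -> (exists i, ~ A (g i)) ->
  exists f : {mpoly R[d]}, nontrivial_mod M f /\ forall a, ~ M f.@[a] -> ~ A (lin a).
Proof.
move=> hA hAg; have [_ M1 inv] := locM.
pose F H := [/\ is_ideal H, forall z, A z -> H z & exists i, ~ H (g i)].
have [||H [[hH AH [i0 Hi0]] Hmax]] := @noetherian_max _ F A nR.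
- by move=> H [].
- by split.
(* Modulo [H] every generator is a multiple of [g i0]: otherwise H + (g i0) would be a larger member
   of [F]. The coefficient 1 at [i0] makes the linear form below nontrivial modulo [M]. *)
have coef i : {c : R | H (g i - c * g i0) /\ (i = i0 -> c = 1)}.
  apply: constructive_indefinite_description.
  have [->|/eqP ne] := eqVneq i i0.
    by exists 1; rewrite mul1r subrr; split=> //; apply: ideal0.
  pose H' z := exists c, H (z - c * g i0).
  have hH' : is_ideal H'.
    split; first by exists 0; rewrite mul0r subrr; apply: ideal0.
      move=> x y [a ha] [b hb]; exists (a + b).
      have -> : x + y - (a + b) * g i0 = (x - a * g i0) + (y - b * g i0) by ring.
      exact: idealD.
    move=> r x [a ha]; exists (r * a).
    have -> : r * x - r * a * g i0 = r * (x - a * g i0) by ring.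
    exact: idealM.
  have HH' z : H z -> H' z by exists 0; rewrite mul0r subr0.
  have [[c hc]|hi] := classic (H' (g i)); first by exists c.
  case: Hi0; apply: (Hmax H') => //; last by exists 1; rewrite mul1r subrr; apply: ideal0.
  by split=> // [z /AH/HH'//|]; exists i.
pose c i := sval (coef i).
have hc i : H (g i - c i * g i0) by case: (svalP (coef i)).
have c1 : c i0 = 1 by case: (svalP (coef i0)) => _; apply.
exists (\sum_i c i *: 'X_i); split.
  exists U_(i0)%MM; rewrite raddf_sum (bigD1 i0) //= mcoeffZ mcoeffX eqxx mulr1 c1.
  rewrite big1 ?addr0 // => i /negbTE ne; rewrite mcoeffZ mcoeffXU ne mulr0 //.
move=> a; rewrite raddf_sum /=.
under eq_bigr do rewrite mevalZ mevalXU.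
set u := \sum_(i < d) _ => /inv[v uv] /AH Ha; apply: Hi0.
have -> : g i0 = v * (lin a - \sum_i a i * (g i - c i * g i0)).
  have -> : lin a - \sum_i a i * (g i - c i * g i0) = u * g i0.
    by rewrite /lin /u -sumrB mulr_suml; apply: eq_bigr => i _; ring.
  by rewrite mulrA [v * u]mulrC uv mul1r.
apply: idealM => //; apply: idealB => //; apply: ideal_big_sum => // i _.
exact: idealM.
Qed.

(** To a maximal counterexample [N1] one adjoins an r whose annihilator modulo [N1] is prime. The
    claim for the larger ideal leaves only multiples y r to treat. If the prime contains every [g i]
    in degree one, y r is in [N1] in large degrees; otherwise a general linear combination avoids
    the prime. *)
Lemma eventually_superficial N : rees_seq M N ->
  exists f : {mpoly R[d]}, nontrivial_mod M f /\ exists c, forall a, ~ M f.@[a] ->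
    forall n r, (c <= n)%N -> ideal_pow M n r -> N n.+1 (r * lin a) -> N n r.
Proof.
pose Q N := exists f : {mpoly R[d]}, nontrivial_mod M f /\
  exists c, forall a, ~ M f.@[a] ->
    forall n r, (c <= n)%N -> ideal_pow M n r -> N n.+1 (r * lin a) -> N n r.
move=> rN0; apply: NNPP => nQ0.
have [||N1 [[rN nQ] Nmax]] := rees_max nR Mg (F := fun N => rees_seq M N /\ ~ Q N) (N0 := N).
- by move=> N' [].
- by split.
have [NI NP NM] := rN; have [_ M1 _] := locM.
have M0 : nontrivial_mod M (1 : {mpoly R[d]}) by exists 0%MM; rewrite mcoeff1 eqxx.
(* The degree n part of the annihilator of the class of r t^j modulo [N1]. *)
pose ann j r n y := ideal_pow M n y /\ N1 (j + n)%N (y * r).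
have rann j r : rees_seq M (ann j r).
  split=> [n|n y []//|n x y hx [hy hN]].
    apply: is_idealI => //; split; first by rewrite mul0r; apply: ideal0.
      by move=> u v; rewrite mulrDl; apply: idealD.
    by move=> u v; rewrite -mulrA; apply: idealM.
  split; first by rewrite mulrC; apply: ideal_mul_mem.
  by rewrite addnS -mulrA; apply: NM.
have [j0 [r0 [Mr0 Nr0]]] : exists j r, ideal_pow M j r /\ ~ N1 j r.
  apply: NNPP => h; apply: nQ; exists 1; split=> //; exists 0%N => a _ n r _ Mr _.
  by apply: NNPP => Nr; apply: h; exists n, r.
have [||_ [[j [r [Mr [Nr ->]]]] annmax]] := rees_max nR Mg
  (F := fun P => exists j r, ideal_pow M j r /\ ~ N1 j r /\ P = ann j r) (N0 := ann j0 r0).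
- by move=> _ [j [r [_ [_ ->]]]].
- by exists j0, r0.
(* The annihilator of the class of r is maximal among annihilators, hence prime;
   N2 below adds the cyclic submodule generated by r to N1. *)
pose A n := if (j <= n)%N then ideal_pow M (n - j) else (fun y => y = 0).
have AI n : is_ideal (A n).
  rewrite /A; case: ifP => // _; split=> //.
    by move=> x y -> ->; rewrite addr0.
  by move=> u v ->; rewrite mulr0.
pose N2 n z := exists w y, [/\ N1 n w, A n y & z = w + y * r].
have rN2 : rees_seq M N2.
  split=> [n|n _ [w [y [hw hy ->]]]|n x _ hx [w [y [hw hy ->]]]].
  - split; first by exists 0, 0; rewrite mul0r addr0; split=> //; apply: ideal0.
      move=> _ _ [w [y [hw hy ->]]] [w' [y' [hw' hy' ->]]].
      by exists (w + w'), (y + y'); split; [exact: idealD | exact: idealD | ring].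
    move=> u _ [w [y [hw hy ->]]]; exists (u * w), (u * y).
    by split; [exact: idealM | exact: idealM | ring].
  - apply: idealD => //; first exact: NP.
    move: hy; rewrite /A; case: leqP => [jn hy|_ ->].
      by rewrite -(subnK jn); apply: ideal_powD.
    by rewrite mul0r; apply: ideal0.
  - exists (x * w), (x * y); split; [exact: NM | | ring].
    move: hy; rewrite /A; case: leqP => [jn hy|_ ->].
      by rewrite leqW // subSn // mulrC; apply: ideal_mul_mem.
    by rewrite mulr0; exact: (ideal0 (AI n.+1)).
have N12 n z : N1 n z -> N2 n z.
  by exists z, 0; rewrite mul0r addr0; split=> //; apply: ideal0.
have [f [nf [c hc]]] : Q N2.
  apply: NNPP => nQ2; apply: Nr; apply: (Nmax N2) => //.
  exists 0, 1; rewrite mul1r add0r; split=> //; first exact: ideal0.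
  by rewrite /A leqnn subnn.
have [MA|] := classic (forall i, ann j r 1 (g i)).
  apply: nQ; exists f; split=> //; exists (maxn c j.+1) => a fa n z.
  rewrite geq_max => /andP[cn jn] Mz Nz.
  have [w [y [Nw + ->]]] := hc a fa n z cn Mz (N12 _ _ Nz).
  rewrite /A (ltnW jn) => My; apply: idealD => //.
  (* As n exceeds j, y lies in a positive power of [M], and a single factor from [M] already sends r
     into [N1]. *)
  have nj : (n - j = (n - j.+1).+1)%N by lia.
  rewrite nj in My; move: y My; apply: (ideal_mul_ind (A := fun y => N1 n (y * r))).
    split; first by rewrite mul0r; apply: ideal0.
      by move=> u v; rewrite mulrDl; apply: idealD.
    by move=> u v; rewrite -mulrA; apply: idealM.
  move=> u v Mu /Mg Mv; rewrite -mulrA.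
  have {1}-> : n = (n - j.+1 + j.+1)%N by lia.
  apply: (rees_powM rN) => //; move: v Mv.
  have [annI _ _] := rann j r.
  move=> v /(generated_ind (annI 1%N) MA)[_]; by rewrite addn1.
move=> /not_all_ex_not hi.
have [annI _ _] := rann j r.
have [f' [nf' hf']] := general_notin (annI 1%N) hi.
apply: nQ; exists (f * f'); split; first exact: nontrivial_mul.
exists (maxn c j) => a fa n z; rewrite geq_max => /andP[cn jn] Mz Nz.
have fa1 : ~ M f.@[a] by move=> h; apply: fa; rewrite mevalM; apply: ideal_mulr.
have fa2 : ~ M f'.@[a] by move=> h; apply: fa; rewrite mevalM; apply: idealM.
have [w [y [Nw + zE]]] := hc a fa1 n z cn Mz (N12 _ _ Nz).
rewrite /A jn => My; rewrite zE; apply: idealD => //.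
have Nxr : ~ N1 (j.+1) (lin a * r).
  move=> h; apply: (hf' _ fa2); split; first exact: ideal_pow1.
  by rewrite addn1.
(* The element [lin a * r] is nonzero modulo [N1]; its annihilator contains that of r, so by
   maximality the two agree. *)
have [_] : ann j r (n - j)%N y; last by rewrite subnKC.
apply: (annmax (ann j.+1 (lin a * r))).
- exists j.+1, (lin a * r); split=> //=.
  by rewrite mulrC; apply: ideal_mul_mem.
- move=> k x [hx hN]; split=> //.
  by rewrite mulrCA addSn; apply: NM.
split=> //; rewrite addSn subnKC //.
have -> : y * (lin a * r) = z * lin a - lin a * w by rewrite zE; ring.
by apply: idealB => //; apply: NM.
Qed.

End Superficial.

(** * Colon ideals of I + K m^n *)

Section ColonStable.
Variables (R : comNzRingType) (M : R -> Prop).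
Hypotheses (nR : noetherian R) (Mid : is_ideal M).
Implicit Types (I K : R -> Prop).

Definition twist K n := ideal_mul K (ideal_pow M n).

Lemma is_ideal_twist K n : is_ideal (twist K n).
Proof. exact/is_ideal_mul/is_ideal_pow. Qed.

Lemma twist_pow K n z : is_ideal K -> twist K n z -> ideal_pow M n z.
Proof.
move=> hK; apply: ideal_mul_ind; first exact: is_ideal_pow.
by move=> x y _; apply: idealM; apply: is_ideal_pow.
Qed.

Lemma twistS K n x z : M x -> twist K n z -> twist K n.+1 (x * z).
Proof.
move=> hx; move: z; apply: (ideal_mul_ind (A := fun z => twist K n.+1 (x * z))).
  have hT := is_ideal_twist K n.+1.
  split; first by rewrite mulr0; apply: (ideal0 hT).
    by move=> u v; rewrite mulrDr; apply: (idealD hT).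
  by move=> r u; rewrite mulrCA; apply: (idealM _ hT).
move=> u v hu hv; rewrite mulrCA; apply: ideal_mul_mem => //.
by rewrite mulrC; apply: ideal_mul_mem.
Qed.

(* Encoding r as the multiple r * xi of the generic linear form
   xi = sum_i g_i X_i turns the colon by M into the colon by xi, to which
   Artin-Rees over R[X_1..X_d] applies. *)
Lemma colon_stable I K : is_ideal I -> is_ideal K ->
  exists c, forall n, (c <= n)%N -> forall r,
    colon (ideal_sum I (twist K n.+1)) M r -> ideal_sum (colon I M) (twist K n) r.
Proof.
move=> hI hK; have [d [g Mg]] := nR Mid.
have Mgi i : M (g i) by apply/Mg; apply: generated_mem.
pose xi : {mpoly R[d]} := \sum_i g i *: 'X_i.
have xi0 : xi@_0 = 0.
  rewrite raddf_sum big1 // => i _.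
  by rewrite /= mcoeffZ mcoeffX mnm1_eq0 mulr0.
have xiU i : xi@_U_(i) = g i.
  rewrite raddf_sum (bigD1 i) //= mcoeffZ mcoeffXU eqxx mulr1 big1 ?addr0 //.
  by move=> j /negbTE ne; rewrite mcoeffZ mcoeffXU ne mulr0.
pose M' := generated_by (fun i : 'I_d => (g i)%:MP_[d]).
have M'I : is_ideal M' by apply: is_ideal_generated.
have cI := @is_ideal_coefs R d I hI.
have cT n := @is_ideal_coefs R d _ (is_ideal_twist K n).
have powM' n c : ideal_pow M n c -> ideal_pow M' n c%:MP.
  elim: n c => [|n IH] //= c; move: c.
  apply: (ideal_mul_ind (A := fun c => ideal_pow M' n.+1 c%:MP)).
    have hP : is_ideal (ideal_pow M' n.+1) by apply: is_ideal_pow.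
    split; first by rewrite mpolyC0; apply: (ideal0 hP).
      by move=> x y; rewrite mpolyCD; apply: (idealD hP).
    by move=> x y; rewrite mpolyCM; apply: (idealM _ hP).
  move=> x y /IH hx hy; rewrite mpolyCM; apply: ideal_mul_mem => //.
  move: (y) hy => {}y /Mg; apply: (generated_ind (A := fun y => M' y%:MP)).
    split; first by rewrite mpolyC0; apply: (ideal0 M'I).
      by move=> u v; rewrite mpolyCD; apply: (idealD M'I).
    by move=> u v; rewrite mpolyCM; apply: (idealM _ M'I).
  by move=> i; apply: (generated_mem (fun i : 'I_d => (g i)%:MP_[d])).
have M'c u : M' u -> coefs_in M u.
  apply: generated_ind; first exact: is_ideal_coefs.
  by move=> i e; rewrite mcoeffC; apply: ideal_mulr.
(* The intersection of K M^n R[X] with I R[X] + (xi). *)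
pose N n w := coefs_in (twist K n) w /\ exists u, coefs_in I (w - xi * u).
have rN : rees_seq M' N.
  split=> [n|n w [hw _]|n x w hx [hw [u hu]]].
  - apply: is_idealI => //; split.
      by exists 0; rewrite mulr0 subr0; apply: (ideal0 cI).
      move=> w w' [u hu] [u' hu']; exists (u + u').
      have -> : w + w' - xi * (u + u') = (w - xi * u) + (w' - xi * u') by ring.
      exact: (idealD cI).
    move=> r w [u hu]; exists (r * u).
    have -> : r * w - xi * (r * u) = r * (w - xi * u) by ring.
    exact: (idealM _ cI).
  - rewrite [w]mpolyE; apply: ideal_big_sum; first exact: is_ideal_pow.
    move=> e _; rewrite -mul_mpolyC; apply: ideal_mulr; first exact: is_ideal_pow.
    by apply: powM'; apply: twist_pow (hw e).
  - split; last first.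
      exists (x * u); have -> : x * w - xi * (x * u) = x * (w - xi * u) by ring.
      exact: (idealM _ cI).
    move: (coefs_in_mul (is_ideal_twist K n) (M'c _ hx) hw).
    apply: coefs_inS; apply: ideal_mul_ind; first exact: is_ideal_twist.
    by move=> a b; apply: twistS.
have [c hc] := rees_stable (noetherian_mpoly nR) (fun z => iff_refl _) rN.
exists c => n cn r hr.
have wit i : {t | twist K n.+1 t /\ I (t - g i * r)}.
  apply: constructive_indefinite_description.
  have [x [t [hx ht E]]] := hr _ (Mgi i); exists t; split=> //.
  have -> : t - g i * r = - x by rewrite mulrC E; ring.
  exact: idealN.
(* The congruences of t_i and g_i r modulo [I] combine into one between w and xi r. *)
pose w := \sum_i sval (wit i) *: 'X_i : {mpoly R[d]}.
have wr : coefs_in I (w - xi * r%:MP).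
  rewrite /w /xi mulr_suml -sumrB; apply: (ideal_big_sum _ cI) => i _.
  rewrite -scalerAl [_ * r%:MP]mulrC mul_mpolyC scalerA -scalerBl.
  by apply: coefs_in_X => //; case: (svalP (wit i)).
have Nw : N n.+1 w.
  split; last by exists r%:MP.
  apply: (ideal_big_sum _ (cT n.+1)) => i _; apply: coefs_in_X.
    exact: is_ideal_twist.
  by case: (svalP (wit i)).
have FI : is_ideal (ideal_sum I (twist K n)) by apply/is_ideal_sum/is_ideal_twist.
have lincoef (A : R -> Prop) u i : coefs_in A (xi * u) -> A (g i * u@_0).
  by move/(_ U_(i)%MM); rewrite mcoeffUM // xiU.
(* Stability writes w as a sum of products a b with a congruent to some xi u and b in [M']. The
   constant term of u b lies in I + K M^n because each g_i u_0 does, being the X_i coefficient of xi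
   u. *)
have [u [wu Fu]] : exists u, coefs_in I (w - xi * u) /\ ideal_sum I (twist K n) u@_0.
  move: (hc n cn w Nw).
  apply: (ideal_mul_ind (A := fun w => exists u,
    coefs_in I (w - xi * u) /\ ideal_sum I (twist K n) u@_0)).
    split.
    - exists 0; rewrite mulr0 subr0 mcoeff0; split; first exact: (ideal0 cI).
      exact: ideal0.
    - move=> a b [u [ua u0]] [v [vb v0]]; exists (u + v); split.
        have -> : a + b - xi * (u + v) = (a - xi * u) + (b - xi * v) by ring.
        exact: (idealD cI).
      by rewrite mcoeffD; apply: idealD.
    - move=> q a [u [ua u0]]; exists (q * u); split.
        have -> : q * a - xi * (q * u) = q * (a - xi * u) by ring.
        exact: (idealM _ cI).
      by rewrite rmorphM; apply: idealM.
  move=> a b [Ta [u ua]] Mb; exists (u * b); split.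
    have -> : a * b - xi * (u * b) = b * (a - xi * u) by ring.
    exact: (idealM _ cI).
  have Fg i : ideal_sum I (twist K n) (g i * u@_0).
    apply: lincoef => e; have -> : xi * u = a - (a - xi * u) by ring.
    rewrite mcoeffB; apply: idealB => //; first by apply: ideal_sumR => //; apply: Ta.
    by apply: ideal_sumL; [exact: is_ideal_twist | exact: ua].
  rewrite rmorphM /= mulrC; have := M'c b Mb 0%MM.
  move: (b@_0) => y /Mg; apply: (generated_ind (A := fun y => ideal_sum I (twist K n) (y * u@_0))).
    split; first by rewrite mul0r; apply: ideal0.
      by move=> p q; rewrite mulrDl; apply: idealD.
    by move=> p q; rewrite -mulrA; apply: idealM.
  exact: Fg.
have hcol : is_ideal (colon I M) by apply: is_ideal_colon.
have sub : ideal_sum (colon I M) (twist K n) u@_0.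
  have [x [t [hx ht ->]]] := Fu; exists x, t; split=> // y _.
  exact: ideal_mulr.
(* Both xi r and xi u are congruent to w modulo [I]; the linear coefficients of their difference put
   r - u_0 in I : M. *)
rewrite -[r](subrK u@_0); apply: idealD => //.
  exact/is_ideal_sum/is_ideal_twist.
apply: ideal_sumL; first exact: is_ideal_twist.
move=> y /Mg; apply: (generated_ind (A := fun y => I ((r - u@_0) * y))).
  split; first by rewrite mulr0; apply: ideal0.
    by move=> p q; rewrite mulrDr; apply: idealD.
  by move=> p q; rewrite mulrCA; apply: idealM.
move=> i; have -> : r - u@_0 = (r%:MP - u)@_0 by rewrite mcoeffB mcoeffC eqxx mulr1.
rewrite mulrC; apply: lincoef.
have -> : xi * (r%:MP - u) = (w - xi * u) - (w - xi * r%:MP) by ring.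
exact: (idealB cI).
Qed.

End ColonStable.

(** * Lifting and descending the condition I : x = L *)

Section GeneralColon.
Variables (R : comNzRingType) (M : R -> Prop).
Hypotheses (nR : noetherian R) (locM : is_local M).
Variables (I L K : R -> Prop).
Hypotheses (hI : is_ideal I) (hL : is_ideal L) (hK : is_ideal K).
Hypotheses (MLI : forall x y, M x -> L y -> I (x * y)) (IL : forall x, I x -> L x).
Let Mid : is_ideal M. Proof. by case: locM. Qed.

Definition general_colon I L := general_elt M (fun x => ideal_eq (colon_elt I x) L).

(** The exponent is one higher than in [Ln], so that the inclusion of M L in I carries over. *)
Let In n := ideal_sum I (twist M K n.+1).
Let Ln n := ideal_sum L (twist M K n).
Let twI n : is_ideal (twist M K n). Proof. exact: is_ideal_twist. Qed.
Let InI n : is_ideal (In n). Proof. exact: is_ideal_sum. Qed.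
Let LnI n : is_ideal (Ln n). Proof. exact: is_ideal_sum. Qed.
Let MLIn n x y : M x -> Ln n y -> In n (x * y).
Proof.
move=> hx [l [t [hl ht ->]]]; rewrite mulrDr; apply: idealD => //.
  by apply: ideal_sumL => //; apply: MLI.
by apply: ideal_sumR => //; apply: twistS.
Qed.
Let linM d (g a : 'I_d -> R) : ideal_eq M (generated_by g) -> M (\sum_i a i * g i).
Proof. by move=> Mg; apply/Mg; exists a. Qed.

(* Apply superficiality to the filtration of M^n by the ideals A :&: M^n. *)
Lemma general_saturation d (g : 'I_d -> R) (A : R -> Prop) :
  ideal_eq M (generated_by g) -> is_ideal A ->
  exists f : {mpoly R[d]}, nontrivial_mod M f /\ exists c, forall a, ~ M f.@[a] ->
    forall r, A (r * \sum_i a i * g i) -> forall y, ideal_pow M c y -> A (y * r).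
Proof.
move=> Mg hA.
have [|f [nf [c hc]]] := @eventually_superficial _ _ _ _ nR locM Mg
  (fun n z => A z /\ ideal_pow M n z).
  split=> [n|n z []//|n x z hx [hz hz']].
    by apply: is_idealI => //; apply: is_ideal_pow.
  by split; [exact: idealM | rewrite mulrC; exact: ideal_mul_mem].
exists f; split=> //; exists c => a fa r Ar y hy.
have My : ideal_pow M c (y * r) by apply: ideal_mulr => //; apply: is_ideal_pow.
case: (hc a fa c (y * r) (leqnn _) My) => //; split.
  by rewrite -mulrA; apply: idealM.
by apply: ideal_mul_mem => //; apply: linM.
Qed.

Lemma general_colon_lift : general_colon I L ->
  exists n0, forall n, (n0 <= n)%N -> general_colon (In n) (Ln n).
Proof.
move=> [d [g [ming [f [nf hf]]]]]; have Mg := ming.1.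
have [c1 hc1] := colon_stable nR Mid hL hK.
have [c2 hc2] := artin_rees_mul nR Mg hL.
have [|f3 [nf3 [c3 hc3]]] := @eventually_superficial _ _ _ _ nR locM Mg
  (fun n z => ideal_sum I (twist M K n.+1) z /\ ideal_pow M n z).
  split=> [n|n z []//|n x z hx [[u [t [hu ht ->]]] hz']].
    by apply: is_idealI => //; [exact: InI | apply: is_ideal_pow].
  split; last by rewrite mulrC; apply: ideal_mul_mem.
  rewrite mulrDr; exists (x * u), (x * t); split=> //; [exact: idealM | exact: twistS].
(* The bounds are needed at the predecessor of the index, where [r'] is split. The open set may vary
   with the index, so [f4] and [c4] are chosen afterwards. *)
exists (c1 + c2 + c3).+1 => -[//|n] hn.
have [f4 [nf4 [c4 hc4]]] := general_saturation Mg (InI n.+1).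
exists d, g; split=> //; exists (f * f3 * f4); split.
  exact/nontrivial_mul/nf4/nontrivial_mul.
move=> a fa.
have [fa1 fa3 fa4] : [/\ ~ M f.@[a], ~ M f3.@[a] & ~ M f4.@[a]].
  split=> h; apply: fa; rewrite !mevalM.
  - by apply: ideal_mulr => //; apply: ideal_mulr.
  - by apply: ideal_mulr => //; apply: idealM.
  - exact: idealM.
have := hf a fa1; have := hc3 a fa3; have := hc4 a fa4; have := linM a Mg.
set x := \sum_i _ => Mx sat sup colx r; split; last first.
  by move=> hr; rewrite /colon_elt mulrC; apply: MLIn.
rewrite /colon_elt => hr; apply: NNPP => nr.
have [|s [ns Ms]] := socle_elt (M := M) (n := c4) (LnI n.+1) nr.
  move=> y /(sat r hr)[u [t [hu ht ->]]]; apply: idealD => //.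
    by apply: ideal_sumL => //; apply: IL.
  apply: ideal_sumR => //; move: t ht; apply: ideal_mul_ind => // u' v hu' hv.
  apply: ideal_mul_mem => //; exact: ideal_pow_le hv.
apply: ns; set r' := s * r.
have hr' : In n.+1 (r' * x) by rewrite -mulrA; apply: idealM.
have c1n : (c1 <= n)%N by lia.
have [|u [t [hu ht E]]] := hc1 n c1n r'.
  by move=> y hy; rewrite mulrC; apply: Ms.
have Lux : L (u * x) by apply: hu.
have hxt : twist M K n.+1 (t * x) by rewrite mulrC; apply: twistS.
(* Here q - t x lies in both L and M^(n+1), so Artin-Rees puts it in L M, hence in I. *)
have Iux : I (u * x).
  have [p [q [hp hq E']]] := hr'.
  have E2 : u * x = p + (q - t * x).
    have -> : u * x = r' * x - t * x by rewrite E; ring.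
    by rewrite E'; ring.
  have Lq : L (q - t * x).
    have -> : q - t * x = u * x - p by rewrite E2; ring.
    by apply: idealB => //; apply: IL.
  have Mq : ideal_pow M n.+1 (q - t * x).
    apply: idealB; [exact: is_ideal_pow | | exact: twist_pow hxt].
    by apply: ideal_pow_le (twist_pow Mid hK hq).
  rewrite E2; apply: idealD => //.
  have : ideal_mul L M (q - t * x) by apply: (hc2 n.+1) => //; lia.
  by apply: ideal_mul_ind => // y z hy hz; rewrite mulrC; apply: MLI.
rewrite E; apply: idealD => //; first by apply: ideal_sumL => //; apply/colx.
have c3n : (c3 <= n)%N by lia.
(* Superficiality cancels x from t x in I + K M^(n+2), at the cost of one power of [M]. *)
have [||[p [q [hp hq ->]]] _] := sup n t c3n.
- exact: twist_pow ht.
- split.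
    have -> : t * x = r' * x - u * x by rewrite E; ring.
    by apply: (idealB (InI n.+1)) => //; apply: ideal_sumL.
  exact: twist_pow hxt.
by exists p, q; split=> //; apply: IL.
Qed.

Lemma general_colon_descend : (exists n0, forall n, (n0 <= n)%N ->
  general_colon (In n) (Ln n)) -> general_colon I L.
Proof.
move=> [n0 hn0].
have colI : is_ideal (colon L M) by apply: is_ideal_colon.
have [d0 [g0 Mg0]] := nR Mid.
have [c hc] := artin_rees_mul nR Mg0 colI.
have [d [g [ming [f [nf hf]]]]] := hn0 (maxn n0 c) (leq_maxl _ _).
have Mg := ming.1.
have [f2 [nf2 [c2 hc2]]] := general_saturation Mg hI.
exists d, g; split=> //; exists (f * f2); split; first exact: nontrivial_mul.
move=> a fa.
have fa1 : ~ M f.@[a] by move=> h; apply: fa; rewrite mevalM; apply: ideal_mulr.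
have fa2 : ~ M f2.@[a] by move=> h; apply: fa; rewrite mevalM; apply: idealM.
have := hf a fa1; have := hc2 a fa2; have := linM a Mg.
set x := \sum_i _ => Mx sat colx r; split; last first.
  by move=> hr; rewrite /colon_elt mulrC; apply: MLI.
rewrite /colon_elt => hr; apply: NNPP => nr.
have [|s [ns Ms]] := socle_elt (M := M) (n := c2) hL nr.
  by move=> y /(sat r hr)/IL.
apply: ns; have /colx[l [t [hl ht E]]] : colon_elt (In (maxn n0 c)) x (s * r).
  by apply: ideal_sumL => //; rewrite -mulrA; apply: idealM.
rewrite E; apply: idealD => //.
(* As the difference of s r, which [M] multiplies into L, and l in L, the element t is in L : M; it
   is also in a high power of [M]. The product M (L : M) lies in L. *)
have : ideal_mul (colon L M) M t.
  apply: (hc (maxn n0 c)); first exact: leq_maxr.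
    have -> : t = s * r - l by rewrite E; ring.
    by apply: (idealB colI) => // y hy; [rewrite mulrC; exact: Ms | exact: ideal_mulr].
  exact: twist_pow ht.
by apply: ideal_mul_ind => // y z; apply.
Qed.

End GeneralColon.

(** * Localization *)

Section Localization.
Variables (A : comNzRingType) (P : A -> Prop).
Local Notation type := (Loc.type P).
Local Notation embed := (Loc.embed P).
Local Notation S := (Loc.S P).

Lemma loc_pi_eq (x y : Loc.dom P) : x.1 * val y.2 = y.1 * val x.2 ->
  \pi_type x = \pi_type y.
Proof. by move=> h; apply/eqmodP/Loc.equiv_of. Qed.

Lemma embed_zmod : zmod_morphism embed.
Proof.
move=> a b; have -> : - embed b = \pi_type (Loc.oppl (b, Loc.one_den P)).
  by symmetry; apply: Loc.pi_opp.
transitivity (\pi_type (Loc.addl (a, Loc.one_den P) (Loc.oppl (b, Loc.one_den P)))).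
  by apply: loc_pi_eq => /=; ring.
exact: Loc.pi_add.
Qed.

Lemma embed_monoid : monoid_morphism embed.
Proof.
split=> // a b.
transitivity (\pi_type (Loc.mull (a, Loc.one_den P) (b, Loc.one_den P))).
  by apply: loc_pi_eq => /=; ring.
exact: Loc.pi_mul.
Qed.

HB.instance Definition _ := GRing.isZmodMorphism.Build A type embed embed_zmod.
HB.instance Definition _ := GRing.isMonoidMorphism.Build A type embed embed_monoid.

Lemma loc_frac (z : type) : exists a s, S s /\ z * embed s = embed a.
Proof.
elim/quotW: z => -[a [s Ss]]; exists a, s; split=> //.
transitivity (\pi_type (Loc.mull (a, exist _ s Ss) (s, Loc.one_den P))).
  by symmetry; apply: Loc.pi_mul.
by apply: loc_pi_eq => /=; ring.
Qed.

Lemma embed_unit s : S s -> exists t, embed s * t = 1.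
Proof.
move=> Ss; exists (\pi_type (1, exist _ s Ss)).
transitivity (\pi_type (Loc.mull (s, Loc.one_den P) (1, exist _ s Ss))).
  by symmetry; apply: Loc.pi_mul.
by apply: loc_pi_eq => /=; ring.
Qed.

Lemma embed_eq0 a : embed a = 0 -> exists u, S u /\ u * a = 0.
Proof.
move=> h; have /eqmodP/asbP[u [Su]] : \pi_type (a, Loc.one_den P) = \pi_type (0, Loc.one_den P).
  exact: h.
by rewrite /= mul0r mulr1 subr0 => ua; exists u.
Qed.

(** Every fraction is a unit multiple of an image from [A], so generators of the contraction
    generate the ideal. *)
Lemma noetherian_loc : noetherian A -> noetherian type.
Proof.
move=> nA; apply: noetherian_of_hull => I hI.
have pre := @is_ideal_preim _ _ embed.
have [s [sI Is]] := noetherian_hull nA (pre I hI).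
exists (map embed s); split=> [_ /mapP[x /sI hx ->] //|z Iz J hJ hs].
have [a [b [Sb zb]]] := loc_frac z; have [t bt] := embed_unit Sb.
rewrite -[z]mulr1 -bt mulrA zb; apply: ideal_mulr => //.
apply: (Is a _ _ (pre J hJ)); first by rewrite /= -zb; apply: ideal_mulr.
by move=> x xs; apply/hs/map_f.
Qed.

End Localization.

(** * Extension of ideals to S' *)

(** Extensionality turns equivalent ideals into equal ones, which can then be rewritten inside the
    fullness predicates. *)
Lemma ideal_ext_eq (T : comNzRingType) (I J : T -> Prop) : ideal_eq I J -> I = J.
Proof.
by move=> h; apply: functional_extensionality => z; apply: propositional_extensionality.
Qed.

Section Extension.
Variables (A B : comNzRingType) (phi : {rmorphism A -> B}).
Implicit Types (I J K M : A -> Prop).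
Local Notation ext := (ideal_ext phi).

(** As a product of the image with the unit ideal, the extension inherits its ideal structure from
    [is_ideal_mul]. *)
Lemma ideal_extE I : ext I = ideal_mul (fun b => exists2 a, I a & b = phi a) (fun=> True).
Proof.
apply: ideal_ext_eq => z; split.
  move=> [k [c [a [aI ->]]]]; exists k, (fun i => phi (a i)), c; split=> //.
    by move=> i; exists (a i).
  by apply: eq_bigr => i _; rewrite mulrC.
move=> [k [b [c [hb _ ->]]]].
have wit i : {a | I a /\ b i = phi a}.
  by apply: constructive_indefinite_description; have [a ? ?] := hb i; exists a.
exists k, c, (fun i => sval (wit i)); split=> [i|]; first by case: (svalP (wit i)).
by apply: eq_bigr => i _; rewrite mulrC; congr (_ * _); case: (svalP (wit i)).
Qed.

Lemma is_ideal_ext I : is_ideal (ext I).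
Proof. by rewrite ideal_extE; apply: is_ideal_mul. Qed.

Lemma ideal_ext_mem I a : I a -> ext I (phi a).
Proof. by move=> Ia; exists 1%N, (fun=> 1), (fun=> a); rewrite big_ord1 mul1r. Qed.

Lemma ideal_ext_ind I (J : B -> Prop) : is_ideal J -> (forall a, I a -> J (phi a)) ->
  forall z, ext I z -> J z.
Proof.
by move=> hJ h _ [k [c [a [aI ->]]]]; apply: ideal_big_sum => // i _; apply: idealM => //; exact: h.
Qed.

Lemma ideal_ext_sum I J : is_ideal I -> is_ideal J ->
  ext (ideal_sum I J) = ideal_sum (ext I) (ext J).
Proof.
move=> hI hJ; apply: ideal_ext_eq => z; split.
  apply: ideal_ext_ind; first exact/is_ideal_sum/is_ideal_ext/is_ideal_ext.
  by move=> _ [x [y [hx hy ->]]]; exists (phi x), (phi y);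
    rewrite rmorphD; split=> //; apply: ideal_ext_mem.
move=> [x [y [hx hy ->]]]; apply: (idealD (is_ideal_ext _)).
  apply: ideal_ext_ind hx => [|a ha]; first exact: is_ideal_ext.
  by apply: ideal_ext_mem; apply: ideal_sumL.
apply: ideal_ext_ind hy => [|a ha]; first exact: is_ideal_ext.
by apply: ideal_ext_mem; apply: ideal_sumR.
Qed.

Lemma ideal_ext_mul I J : ext (ideal_mul I J) = ideal_mul (ext I) (ext J).
Proof.
have eI := is_ideal_ext (ideal_mul I J).
have mI := @is_ideal_mul _ (ext I) _ (is_ideal_ext J).
apply: ideal_ext_eq => z; split.
  apply: ideal_ext_ind => //; apply: ideal_mul_ind; first exact: is_ideal_preim.
  by move=> x y hx hy; rewrite rmorphM; apply: ideal_mul_mem; apply: ideal_ext_mem.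
apply: ideal_mul_ind => // x y + hy; move: x.
apply: (ideal_ext_ind (J := fun x => ext (ideal_mul I J) (x * y))).
  split; first by rewrite mul0r; apply: (ideal0 eI).
    by move=> u v; rewrite mulrDl; apply: (idealD eI).
  by move=> u v; rewrite -mulrA; apply: (idealM _ eI).
move=> a ha; move: y hy.
apply: (ideal_ext_ind (J := fun y => ext (ideal_mul I J) (phi a * y))).
  split; first by rewrite mulr0; apply: (ideal0 eI).
    by move=> u v; rewrite mulrDr; apply: (idealD eI).
  by move=> u v; rewrite mulrCA; apply: (idealM _ eI).
by move=> b hb; rewrite -rmorphM; apply: ideal_ext_mem; apply: ideal_mul_mem.
Qed.

Lemma ideal_ext_twist M K n : ext (twist M K n) = twist (ext M) (ext K) n.
Proof.
rewrite /twist ideal_ext_mul; congr ideal_mul.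
elim: n => [|n IH] /=; last by rewrite ideal_ext_mul IH.
apply: ideal_ext_eq => z; split=> // _.
by rewrite -[z]mulr1 -(rmorph1 phi); apply: idealM; [exact: is_ideal_ext | exact: ideal_ext_mem].
Qed.

End Extension.

(** * S' is a Noetherian local ring *)

Section SprimeLocal.
Variables (R : comNzRingType) (M : R -> Prop) (n : nat).
Hypotheses (nR : noetherian R) (locM : is_local M).
Let Mid : is_ideal M. Proof. by case: locM. Qed.
Local Notation S' := (@Sprime R M n).
Local Notation P := (@notin_mS R M n).
Local Notation embed := (Loc.embed P).

Lemma to_Sprime_zmod : zmod_morphism (@to_Sprime R M n).
Proof. by move=> x y; rewrite /to_Sprime mpolyCB rmorphB. Qed.
Lemma to_Sprime_monoid : monoid_morphism (@to_Sprime R M n).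
Proof. by split=> [|x y]; rewrite /to_Sprime ?mpolyC1 ?rmorph1 // mpolyCM rmorphM. Qed.
HB.instance Definition _ :=
  GRing.isZmodMorphism.Build R S' (@to_Sprime R M n) to_Sprime_zmod.
HB.instance Definition _ :=
  GRing.isMonoidMorphism.Build R S' (@to_Sprime R M n) to_Sprime_monoid.

(** Closure under products is Gauss's lemma. Hence S' is the intended localization and not the
    default one at 1. *)
Lemma notin_mS_good : Loc.good P.
Proof.
have [_ M1 _] := locM; split.
- by move=> /(_ 0%MM); rewrite mcoeff1 eqxx.
- move=> p q /not_all_ex_not hp /not_all_ex_not hq h.
  by have [e] := nontrivial_mul locM hp hq; apply.
- by apply=> e; rewrite mcoeff0; apply: ideal0.
Qed.

Lemma SprimeS p : Loc.S P p <-> P p.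
Proof.
rewrite /Loc.S; case: asbP => [_|[]]; last exact: notin_mS_good.
by split=> [/asbP|h]; last apply/asbP.
Qed.

Local Notation M' := (ideal_ext (@to_Sprime R M n) M).

Lemma mS_embed p : coefs_in M p -> M' (embed p).
Proof.
have M'I : is_ideal M' by apply: is_ideal_ext.
move=> hp; rewrite [p]mpolyE rmorph_sum; apply: ideal_big_sum => // e _ /=.
rewrite -mul_mpolyC rmorphM; apply: ideal_mulr => //.
exact: (ideal_ext_mem _ (hp e)).
Qed.

(** Together with [mS_embed], this identifies the extension of m with the fractions whose numerator
    lies in m R[X]. *)
Lemma mS_frac z : M' z -> exists p s, [/\ coefs_in M p, Loc.S P s & z * embed s = embed p].
Proof.
have cI := @is_ideal_coefs R n M Mid.
move: z; apply: ideal_ext_ind.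
  split.
  - exists 0, 1; rewrite mul0r rmorph0; split=> //; [exact: (ideal0 cI) | exact: Loc.S1].
  - move=> x y [p [s [hp hs xp]]] [q [t [hq ht yq]]].
    exists (p * t + q * s), (s * t); split; last 1 first.
    + by rewrite rmorphD !rmorphM /= -xp -yq; ring.
    + by apply: (idealD cI); apply: (ideal_mulr _ cI).
    + exact: Loc.SM.
  - move=> r x [p [s [hp hs xp]]]; have [b [t [ht rb]]] := loc_frac r.
    exists (b * p), (t * s); split; [exact: (idealM _ cI) | exact: Loc.SM |].
    by rewrite !rmorphM /= -xp -rb; ring.
move=> a ha; exists a%:MP, 1; rewrite rmorph1 mulr1; split=> //; last exact: Loc.S1.
by move=> e; rewrite mcoeffC; apply: ideal_mulr.
Qed.

Lemma is_local_Sprime : is_local M'.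
Proof.
have cI := @is_ideal_coefs R n M Mid.
split; first exact: is_ideal_ext.
  (* If 1 were in the extension, then u s = u p with u and s outside the prime m R[X] but p inside
     it. *)
  move=> /mS_frac[p [s [hp hs]]]; rewrite mul1r => /esym/eqP.
  rewrite -subr_eq0 -rmorphB => /eqP/embed_eq0[u [hu]].
  rewrite mulrBr => /eqP; rewrite subr_eq0 => /eqP E.
  have /SprimeS := Loc.SM hu hs; apply; rewrite -E; exact: (idealM _ cI).
move=> z hz; have [p [s [hs zs]]] := loc_frac z.
have Pp : Loc.S P p.
  apply/SprimeS => hp; apply: hz; have [t st] := embed_unit hs.
  rewrite -[z]mulr1 -st mulrA zs; apply: ideal_mulr; first exact: is_ideal_ext.
  exact: mS_embed.
have [t pt] := embed_unit Pp; exists (embed s * t).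
by rewrite mulrA zs.
Qed.

Lemma noetherian_Sprime : noetherian S'.
Proof. exact/noetherian_loc/noetherian_mpoly. Qed.

End SprimeLocal.

(** * The equivalences *)

Section Fullness.
Variables (R : comNzRingType) (M : R -> Prop).
Hypotheses (nR : noetherian R) (locM : is_local M).
Variables (J K : R -> Prop).
Hypotheses (hJ : is_ideal J) (hK : is_ideal K).
Let Mid : is_ideal M. Proof. by case: locM. Qed.
Let twI n : is_ideal (twist M K n). Proof. exact: is_ideal_twist. Qed.
Local Notation Jn n := (ideal_sum J (twist M K n)).

Lemma mul_sum_twist n : ideal_mul M (Jn n) = ideal_sum (ideal_mul M J) (twist M K n.+1).
Proof.
have JnI : is_ideal (Jn n) by apply: is_ideal_sum.
have MJI : is_ideal (ideal_mul M J) by apply: is_ideal_mul.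
apply: ideal_ext_eq => z; split.
  apply: ideal_mul_ind; first exact: is_ideal_sum.
  move=> x _ hx [j [t [hj ht ->]]]; rewrite mulrDr.
  by exists (x * j), (x * t); split=> //; [exact: ideal_mul_mem | exact: twistS].
have MJnI : is_ideal (ideal_mul M (Jn n)) by apply: is_ideal_mul.
move=> [x [y [hx hy ->]]]; apply: idealD => //.
  apply: ideal_mul_ind hx => // a b ha hb; apply: ideal_mul_mem => //.
  exact: ideal_sumL.
apply: ideal_mul_ind hy => // k w hk; move: w.
apply: (ideal_mul_ind (A := fun w => ideal_mul M (Jn n) (k * w))).
  split; first by rewrite mulr0; apply: (ideal0 MJnI).
    by move=> u v; rewrite mulrDr; apply: (idealD MJnI).
  by move=> u v; rewrite mulrCA; apply: (idealM _ MJnI).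
move=> a b ha hb; rewrite mulrA mulrC; apply: ideal_mul_mem => //.
by apply: ideal_sumR => //; apply: ideal_mul_mem.
Qed.

(** One inclusion is [colon_stable], the other direct. Fullness of J + K M^(n+1) thus becomes a
    [general_colon] condition for the pair J, J : M. *)
Lemma colon_sum_twist : exists c, forall n, (c <= n)%N ->
  colon (Jn n.+1) M = ideal_sum (colon J M) (twist M K n).
Proof.
have [c hc] := colon_stable nR Mid hJ hK; exists c => n cn.
apply: ideal_ext_eq => z; split; first exact: hc.
move=> [x [t [hx ht ->]]] y hy; rewrite mulrDl; apply: idealD.
- exact: is_ideal_sum.
- by apply: ideal_sumL => //; apply: hx.
- by apply: ideal_sumR => //; rewrite mulrC; apply: twistS.
Qed.

Lemma mfull_gen_iff :
  mfull_gen M J <-> exists n0, forall n, (n0 <= n)%N -> mfull_gen M (Jn n).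
Proof.
have MJI : is_ideal (ideal_mul M J) by apply: is_ideal_mul.
have sub x : ideal_mul M J x -> J x.
  by apply: ideal_mul_ind => // a b _; apply: idealM.
have E n : mfull_gen M (Jn n) =
    general_colon M (ideal_sum (ideal_mul M J) (twist M K n.+1)) (Jn n).
  by rewrite /mfull_gen mul_sum_twist.
split=> [h|[n0 h]].
  have [n0 hn0] := general_colon_lift nR locM MJI hJ hK
    (fun x y => @ideal_mul_mem _ M J x y) sub h.
  by exists n0 => n hn; rewrite E; apply: hn0.
apply: (general_colon_descend nR locM MJI hJ hK) => //.
  by move=> x y; apply: ideal_mul_mem.
by exists n0 => n hn; rewrite -E; apply: h.
Qed.

Lemma full_gen_iff :
  full_gen M J <-> exists n0, forall n, (n0 <= n)%N -> full_gen M (Jn n).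
Proof.
have cI : is_ideal (colon J M) by apply: is_ideal_colon.
have MLI x y : M x -> colon J M y -> J (x * y) by move=> hx hy; rewrite mulrC; apply: hy.
have sub x : J x -> colon J M x by move=> hx y _; apply: ideal_mulr.
have [c hc] := colon_sum_twist.
have E n : (c <= n)%N -> full_gen M (Jn n.+1) =
    general_colon M (Jn n.+1) (ideal_sum (colon J M) (twist M K n)).
  by move=> cn; rewrite /full_gen hc.
split=> [h|[n0 h]].
  have [n0 hn0] := general_colon_lift nR locM hJ cI hK MLI sub h.
  exists (maxn c n0).+1 => -[//|n]; rewrite ltnS geq_max => /andP[cn hn].
  by rewrite E //; apply: hn0.
apply: (general_colon_descend nR locM hJ cI hK MLI sub).
exists (maxn c n0) => n; rewrite geq_max => /andP[cn hn].
by rewrite -E //; apply: h; apply: leqW.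
Qed.

(** Upwards, [colon_stable] for m J computes the colon of m J + K m^(n+1). Downwards, z in m J : m
    is x + t with x in J and t in K m^n; then t is in J : m and in m^n, hence in m (J : m), inside
    J. *)
Lemma weakly_mfull_iff :
  weakly_mfull M J <-> exists n0, forall n, (n0 <= n)%N -> weakly_mfull M (Jn n).
Proof.
have MJI : is_ideal (ideal_mul M J) by apply: is_ideal_mul.
have [c hc] := colon_stable nR Mid MJI hK.
have le z : J z -> colon (ideal_mul M J) M z.
  by move=> hz y hy; rewrite mulrC; apply: ideal_mul_mem.
split=> [h|[n0 h]].
  exists c => n cn z; rewrite mul_sum_twist; split.
    by move=> /(hc n cn)[x [t [/h hx ht ->]]]; exists x, t.
  move=> [x [t [hx ht ->]]] y hy; rewrite mulrC mulrDr.
  by exists (y * x), (y * t); split=> //; [exact: ideal_mul_mem | exact: twistS].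
move=> z; split; last exact: le.
have colI : is_ideal (colon J M) by apply: is_ideal_colon.
have [d [g Mg]] := nR Mid; have [e he] := artin_rees_mul nR Mg colI.
pose n := maxn n0 e; move=> hz.
have Jz : colon J M z.
  by move=> y /hz; apply: ideal_mul_ind => // a b _; apply: idealM.
have /(h n (leq_maxl _ _))[x [t [hx ht E]]] : colon (ideal_mul M (Jn n)) M z.
  by move=> y /hz hy; rewrite mul_sum_twist; apply: ideal_sumL.
rewrite E; apply: idealD => //.
have : ideal_mul (colon J M) M t.
  apply: (he n (leq_maxr _ _)); last exact: twist_pow ht.
  have -> : t = z - x by rewrite E; ring.
  by apply: (idealB colI) => // y _; apply: ideal_mulr.
by apply: ideal_mul_ind => // a b; apply.
Qed.

End Fullness.

(** Reduces the quantifier over n in the finite residue field case to a single ring S'. *)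
Lemma mu_unique (R : comNzRingType) (M : R -> Prop) m n : mu M m -> mu M n -> m = n.
Proof.
move=> [g [hg gmin]] [h [hh hmin]]; apply/eqP; rewrite eqn_leq.
by rewrite (gmin _ h) // (hmin _ g).
Qed.

(** [Q] is given over all rings so that its equivalence applies to R or to S' according to the
    residue field; extension to S' commutes with sums and twists. *)
Lemma has_genprop_iff (R : comNzRingType) (M J K : R -> Prop)
    (Q : forall T : comNzRingType, (T -> Prop) -> (T -> Prop) -> Prop) :
  (forall (T : comNzRingType) (m : T -> Prop), noetherian T -> is_local m ->
     forall I L, is_ideal I -> is_ideal L ->
     (Q T m I <-> exists n0, forall n, (n0 <= n)%N -> Q T m (ideal_sum I (twist m L n)))) ->
  noetherian R -> is_local M -> is_ideal J -> is_ideal K ->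
  let prop I := (res_infinite M -> Q R M I) /\
    (~ res_infinite M -> forall n, mu M n -> Q (Sprime M n)
       (ideal_ext (@to_Sprime R M n) M) (ideal_ext (@to_Sprime R M n) I)) in
  prop J <-> exists n0, forall n, (n0 <= n)%N -> prop (ideal_sum J (twist M K n)).
Proof.
move=> hQ nR locM hJ hK prop; have [Mid _ _] := locM.
have [ri|nri] := classic (res_infinite M).
  have E I : prop I <-> Q R M I by split=> [[/(_ ri)]|].
  rewrite E (hQ _ _ nR locM _ _ hJ hK).
  by split=> -[n0 h]; exists n0 => n /h/E.
(* Without a value of [mu], the clause for finite residue fields is vacuous and both sides hold. *)
have [[m mum]|nmu] := classic (exists m, mu M m); last first.
  have all I : prop I by split=> // _ n mun; case: nmu; exists n.
  by split=> // _; exists 0%N.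
have E I : prop I <-> Q (Sprime M m)
    (ideal_ext (@to_Sprime R M m) M) (ideal_ext (@to_Sprime R M m) I).
  by split=> [[_ /(_ nri m mum)] //|h]; split=> // _ n /(mu_unique mum) <-.
rewrite E (hQ _ _ _ _ _ (ideal_ext (@to_Sprime R M m) K)); last 4 first.
- exact: noetherian_Sprime.
- exact: is_local_Sprime.
- exact: is_ideal_ext.
- exact: is_ideal_ext.
have Ext n : ideal_ext (@to_Sprime R M m) (ideal_sum J (twist M K n)) =
    ideal_sum (ideal_ext (@to_Sprime R M m) J)
      (twist (ideal_ext (@to_Sprime R M m) M) (ideal_ext (@to_Sprime R M m) K) n).
  by rewrite ideal_ext_sum ?ideal_ext_twist //; apply: is_ideal_twist.
by split=> -[n0 h]; exists n0 => n /h; rewrite E Ext.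
Qed.

Theorem theorem3p4 (R : comNzRingType) (M : R -> Prop) (P : fullness)
    (J K : R -> Prop) :
  noetherian R -> is_local M -> is_ideal J -> is_ideal K ->
  (has_prop P M J <->
   exists n0 : nat, forall n : nat, (n0 <= n)%N ->
     has_prop P M (ideal_sum J (ideal_mul K (ideal_pow M n)))).
Proof.
move=> nR locM hJ hK; case: P => /=.
- exact: (has_genprop_iff mfull_gen_iff).
- exact: weakly_mfull_iff.
- exact: (has_genprop_iff full_gen_iff).
Qed.
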